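(* Let $\mathbb B$ be a complete Boolean algebra and $U$ an ultrafilter on $\mathbb B$ such that $\mathrm V^{\mathbb B}/U$ is well-founded. If there is a simple skeleton $\mathfrak A$ for $(\mathbb B,U)$, then the Bukovský–Dehornoy phenomenon holds for the Boolean ultrapower of $\mathrm V$ by $U$, that is, \[\mathrm V^{\mathbb B}/U=\bigcap_{A\in\mathfrak A}M_A.\]
   Context: Let $U\in\mathrm V$ be an ultrafilter on $\mathbb B$. $\mathrm V^{\mathbb B}/U$ consists of the classes $[\sigma]_U$ of $\mathbb B$-names under $\sigma\sim\tau$ iff $[\![\sigma=\tau]\!]\in U$, with $[\sigma]_U\,E\,[\tau]_U$ iff $[\![\sigma\in\tau]\!]\in U$. The Boolean ultrapower $\check{\mathrm V}_U\subseteq\mathrm V^{\mathbb B}/U$ consists of the classes of names with $[\![\sigma\in\check{\mathrm V}]\!]=\bigvee_{x\in\mathrm V}[\![\sigma=\check x]\!]\in U$, and $j:\mathrm V\to\check{\mathrm V}_U$, $j(x)=[\check x]_U$, is the Boolean ultrapower embedding. $\dot G$ is the canonical name for the generic filter and $G=[\dot G]_U$; $G$ is $j(\mathbb B)$-generic over $\check{\mathrm V}_U$ and $\check{\mathrm V}_U[G]=\mathrm V^{\mathbb B}/U$. As $\mathrm V^{\mathbb B}/U$ is well-founded, all these models are taken to be transitive. For a maximal antichain $A\subseteq\mathbb B$ (of nonzero elements), $U_A=\{X\subseteq A\mid\bigvee X\in U\}$, $M_A$ is the (transitive) ultrapower of $\mathrm V$ by $U_A$, $\pi_{0,A}:\mathrm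 V\to M_A$ is the ultrapower embedding, and $b_A$ is the unique element of $j(A)\cap G$. $B\le^*A$ ($B$ refines $A$) means every $b\in B$ is below some $a\in A$; then $\pi_{A,B}:M_A\to M_B$ sends $[f]_{U_A}$ to the class of $b\mapsto f(a)$, $a\in A$ unique with $b\le a$. $\check{\mathrm V}_U$ is the direct limit of this system, with direct limit maps $\pi_{A,\infty}:M_A\to\check{\mathrm V}_U$, $\pi_{A,\infty}([f]_{U_A})=j(f)(b_A)$. Let $G_A=\pi_{A,\infty}^{-1}[G]$. The antichain $A$ is simple (with respect to $U$) if $G_A\in M_A$. A skeleton for $(\mathbb B,U)$ is a set $\mathfrak A$ of maximal antichains of $\mathbb B$ such that (1) $\mathfrak A$ is directed under refinement (any two members have a common refinement in $\mathfrak A$), (2) $j[\mathfrak A]=\{j(A)\mid A\in\mathfrak A\}\in\mathrm V^{\mathbb B}/U$, and (3) $\check{\mathrm V}_U=\{j(f)(b_A)\mid A\in\mathfrak A,\ f:A\to\mathrm V\}$. It is simple if every $A\in\mathfrak A$ is simple. *)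

(* Defs.v *)
From mathcomp Require Import all_boot all_order.
From mathcomp Require Import boolp classical_sets.

Set Implicit Arguments.
Unset Strict Implicit.
Unset Printing Implicit Defensive.

Local Open Scope classical_set_scope.

(* The universe of sets.  Classes are arbitrary predicates [set V], so
   Separation and Replacement are single axioms and Foundation is stated as the
   well-foundedness of membership. *)
Record universe := Universe {
  carrier :> Type;
  smem : carrier -> carrier -> Prop;
  empty : carrier;
  extensionality_ax : forall x y, (forall z, smem z x <-> smem z y) -> x = y;
  smem_wf : well_founded smem;
  empty_ax : forall z, ~ smem z empty;
  pairing_ax : forall x y, exists p, forall z, smem z p <-> z = x \/ z = y;
  union_ax : forall x, exists u, forall z, smem z u <-> exists2 y, smem y x & smem z y;
  powerset_ax : forall x, exists p, forall z,
    smem z p <-> (forall w, smem w z -> smem w x);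
  separation_ax : forall (P : set carrier) x, exists s, forall z,
    smem z s <-> smem z x /\ P z;
  replacement_ax : forall (F : carrier -> carrier -> Prop) x,
    (forall y z z', smem y x -> F y z -> F y z' -> z = z') ->
    exists s, forall z, smem z s <-> exists2 y, smem y x & F y z;
  infinity_ax : exists x, smem empty x /\
    forall y, smem y x ->
      exists2 s, smem s x & forall z, smem z s <-> smem z y \/ z = y;
  choice_ax : forall x,
    (forall y, smem y x -> exists z, smem z y) ->
    (forall y y' z, smem y x -> smem y' x -> smem z y -> smem z y' -> y = y') ->
    exists c, forall y, smem y x -> exists! z, smem z c /\ smem z y
}.

Arguments smem {_}.
Arguments empty {_}.
Arguments smem_wf : clear implicits.

Notation "x ∈ y" := (smem x y) (at level 70, no associativity).

(* An element of [P]; the default [x0] is taken when [P] is empty. *)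
Definition the (T : Type) (x0 : T) (P : set T) : T :=
  @xget {classic T} x0 P.

Section Sets.
Variable V : universe.
Implicit Types (x y z : V) (P : set V).

Definition elt (x : V) := {y : V | y ∈ x}.

Definition ext_of x : set V := [set z | z ∈ x].

(* The class [P] belongs to the class [M] (of sets). *)
Definition class_in P (M : set V) : Prop := exists2 x, M x & ext_of x = P.

Definition is_small P : Prop := exists x, ext_of x = P.

(* {x | P x}, with junk value [empty] when [P] is a proper class. *)
Definition collect P : V := the empty [set x | ext_of x = P].

Definition upair x y : V := collect [set x; y].

Definition opair x y : V := upair (upair x x) (upair x y).

(* The value at [x] of a set [f] of ordered pairs. *)
Definition app (f x : V) : V := the empty [set y | opair x y ∈ f].

(* The transitive (Mostowski) collapse p c = {p d | d E c}; it exists and is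
   unique when [E] is well-founded and set-like. *)
Definition collapse (X : Type) (E : X -> X -> Prop) : X -> V :=
  the (fun=> empty)
      [set p : X -> V | forall c, ext_of (p c) = [set p d | d in [set d | E d c]]].

End Sets.

Section BooleanAlgebra.
Variables (d : Order.disp_t) (B : ctbDistrLatticeType d).
Implicit Types (A U : set B) (a b : B).

Definition is_complete : Prop := forall A, supremums A !=set0.

Definition bsup A : B := supremum (Order.bottom : B) A.
Definition binf A : B := infimum (Order.top : B) A.
Definition bimp a b : B := Order.join (Order.compl a) b.

Definition ultrafilter U : Prop :=
  [/\ U Order.top /\ ~ U Order.bottom,
      (forall a b, U a -> (a <= b)%O -> U b),
      (forall a b, U a -> U b -> U (Order.meet a b))
    & (forall a, U a \/ U (Order.compl a))].

Definition antichain A : Prop :=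
  (forall a, A a -> a <> Order.bottom) /\
  (forall a b, A a -> A b -> a <> b -> Order.meet a b = Order.bottom).

Definition maximal_antichain A : Prop :=
  antichain A /\ forall A', antichain A' -> A `<=` A' -> A' = A.

Definition refines A' A : Prop :=
  forall b, A' b -> exists2 a, A a & (b <= a)%O.

Definition directed_under_refinement (F : set (set B)) : Prop :=
  forall A A', F A -> F A' -> exists2 C, F C & refines C A /\ refines C A'.

End BooleanAlgebra.

Section Names.
Variables (V : universe) (d : Order.disp_t) (B : ctbDistrLatticeType d).

(* [Name s v] is the B-name {(s i, v i) | i ∈ D}. *)
Inductive name : Type :=
  Name (D : V) of (elt D -> name) & (elt D -> B).
Arguments Name {D}.

Fixpoint eq_val (σ τ : name) : B :=
  let: @Name _ s v := σ in
  let: @Name _ t w := τ in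
  Order.meet
    (binf [set bimp (v i)
             (bsup [set Order.meet (w k) (eq_val (s i) (t k)) | k in setT])
          | i in setT])
    (binf [set bimp (w k)
             (bsup [set Order.meet (v i) (eq_val (s i) (t k)) | i in setT])
          | k in setT]).

Definition mem_val (σ τ : name) : B :=
  let: @Name _ t w := τ in
  bsup [set Order.meet (w k) (eq_val σ (t k)) | k in setT].

(* check x is the name {(check y, 1) | y ∈ x} *)
Definition check : V -> name :=
  Fix (smem_wf V) (fun=> name)
    (fun x rec => Name (fun y : elt x => rec (sval y) (svalP y))
                       (fun=> Order.top)).

(* The Boolean value that σ belongs to the ground model. *)
Definition ground_val (σ : name) : B :=
  bsup [set eq_val σ (check x) | x in setT].

End Names.

(* Throughout, [code : B -> V] is an injection whose range is a set; it makes B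
   an element of V. *)
Section Ultrapower.
Variables (V : universe) (d : Order.disp_t) (B : ctbDistrLatticeType d).
Variables (code : B -> V) (U : set B).

Local Notation name := (name V B).

Definition code_set (A : set B) : V := collect [set code a | a in A].

Definition decode (x : V) : B := the Order.bottom [set b | code b = x].

(* {(check b, b) | b ∈ B} *)
Definition generic_name : name :=
  Name (fun x : elt (code_set setT) => check B (sval x))
       (fun x => decode (sval x)).

Definition name_class (σ : name) : set name := [set τ | U (eq_val σ τ)].

(* The membership relation of V^B/U. *)
Definition name_mem (C D : set name) : Prop :=
  exists σ τ, [/\ C = name_class σ, D = name_class τ & U (mem_val σ τ)].

Definition well_founded_VBU : Prop := well_founded name_mem.

(* The element of the transitive model V^B/U given by a name.  The Boolean
   ultrapower is a transitive part of V^B/U, so the same map collapses it. *)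
Definition eval (σ : name) : V := collapse V name_mem (name_class σ).

Definition VBU : set V := [set eval σ | σ in setT].

Definition boolean_ultrapower : set V :=
  [set eval σ | σ in [set σ | U (ground_val σ)]].

Definition jmap (x : V) : V := eval (check B x).

Definition generic : V := eval generic_name.

Section Antichain.
Variable A : set B.

(* Functions A -> V are represented by functions on B; every notion below only
   depends on their restrictions to A. *)
Implicit Types f g : B -> V.

Definition graph f : V := collect [set opair (code a) (f a) | a in A].

Definition UA (X : set B) : Prop := X `<=` A /\ U (bsup X).

Definition fun_class f : set (B -> V) :=
  [set g | UA [set a | A a /\ f a = g a]].

(* The membership relation of the ultrapower of V by U_A. *)
Definition fun_mem (C D : set (B -> V)) : Prop :=
  exists f g, [/\ C = fun_class f, D = fun_class g
                & UA [set a | A a /\ f a ∈ g a]].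

Definition fun_eval f : V := collapse V fun_mem (fun_class f).

Definition MA : set V := [set fun_eval f | f in setT].

Definition bA : V :=
  the empty [set x | x ∈ jmap (code_set A) /\ x ∈ generic].

Definition j_at f : V := app (jmap (graph f)) bA.

(* The direct limit map from M_A to the Boolean ultrapower. *)
Definition pi_infty (y : V) : V :=
  the empty [set z | exists2 f, y = fun_eval f & z = j_at f].

Definition GA : set V := [set y | MA y /\ pi_infty y ∈ generic].

Definition simple_antichain : Prop := class_in GA MA.

End Antichain.

Definition skeleton (F : set (set B)) : Prop :=
  [/\ (forall A, F A -> maximal_antichain A),
      directed_under_refinement F,
      class_in [set jmap (code_set A) | A in F] VBU
    & boolean_ultrapower =
      [set z | exists A, F A /\ exists f, z = j_at A f]].

Definition simple_skeleton (F : set (set B)) : Prop :=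
  skeleton F /\ forall A, F A -> simple_antichain A.

End Ultrapower.

Arguments well_founded_VBU V {d B} U.
Arguments VBU V {d B} U.
Arguments boolean_ultrapower V {d B} U.
Arguments MA V {d B} U A.

(* Main.v *)
Require Import Defs.
From mathcomp Require Import all_boot all_order.
From mathcomp Require Import boolp classical_sets wochoice.

Set Implicit Arguments.
Unset Strict Implicit.
Unset Printing Implicit Defensive.

Import Order.Theory.

Local Open Scope classical_set_scope.

(* The inclusion from left to right: if A is simple, G_A is represented in M_A by
   a |-> W_a, and [c]_{U_A} is in G_A iff the mixture of the c(a) along A is in U.
   Hence almost every W_a is an ultrafilter with well-founded quotient, and by
   induction the element of V^B/U named by a name σ is the class in M_A of
   a |-> (the element of V^B/W_a named by σ).

   The converse is proved by ∈-induction.  Let X be in every M_A, X = [f_A]_{U_A},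
   and choose names s_x for the elements x of X.  By the first part, x is in X iff
   v_{A,x} = sup {a in A | (the element of V^B/W_a named by s_x) is in f_A(a)} is in
   U, for every A in the skeleton.  With η a name of j[F], let u_x be the Boolean
   value of "v_{A,x} for all A with j(A) in η"; then {(s_x, u_x) | x in X} names X.
   An element of that name is piecewise one of the s_x, by a choice of pieces which,
   as the skeleton generates the ultrapower, is constant on the members of a
   single A; evaluating at this A shows that it is in X. *)

Lemma theP (T : Type) (x0 : T) (P : set T) : (exists x, P x) -> P (the x0 P).
Proof. by move=> Pex; rewrite /the; apply: (@xgetPex {classic T}). Qed.

Lemma choice_in (T S : Type) (s0 : S) (P : T -> Prop) (R : T -> S -> Prop) :
  (forall x, P x -> exists y, R x y) ->
  exists f : T -> S, forall x, P x -> R x (f x).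
Proof.
move=> PR; have /choice[f fP] : forall x, exists y, P x -> R x y.
  move=> x; have [/PR[y Ry]|nP] := EM (P x); first by exists y.
  by exists s0.
by exists f.
Qed.

(** * Sets of the universe, types of the size of a set, and the collapse *)

Section Sets.
Variable V : universe.
Implicit Types (x y z : V) (P Q : set V).

Lemma set_ext x y : (forall z, z ∈ x <-> z ∈ y) -> x = y.
Proof. exact: extensionality_ax. Qed.

Lemma collectE P : is_small P -> ext_of (collect P) = P.
Proof. exact: theP. Qed.

Lemma in_collect P z : is_small P -> z ∈ collect P <-> P z.
Proof. by move/collectE => {2}<-. Qed.

Lemma is_small_sub P Q : P `<=` Q -> is_small Q -> is_small P.
Proof.
move=> PQ [q qE]; have [s sP] := separation_ax P q; exists s.
rewrite predeqE => z; split; first by move=> /sP[].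
by move=> Pz; apply/sP; split=> //; have := PQ _ Pz; rewrite -qE.
Qed.

Lemma is_small_elt x : is_small (ext_of x).
Proof. by exists x. Qed.

Lemma is_small_upair x y : is_small [set x; y].
Proof.
have [p pP] := pairing_ax x y; exists p.
by rewrite predeqE => z; exact: pP.
Qed.

Lemma in_upair x y z : z ∈ upair x y <-> z = x \/ z = y.
Proof. exact: (in_collect _ (is_small_upair x y)). Qed.

Lemma upair_inj x y x' y' : upair x y = upair x' y' ->
  (x = x' /\ y = y') \/ (x = y' /\ y = x').
Proof.
move=> e.
have h z : (z = x \/ z = y) <-> (z = x' \/ z = y') by rewrite -!in_upair e.
have [] := (h x).1 (or_introl erefl); have [] := (h y).1 (or_intror erefl);
have [] := (h x').2 (or_introl erefl); have [] := (h y').2 (or_intror erefl);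
intuition congruence.
Qed.

Lemma opair_inj x y x' y' : opair x y = opair x' y' -> x = x' /\ y = y'.
Proof.
rewrite /opair => /upair_inj[] [/upair_inj + /upair_inj]; intuition congruence.
Qed.

(** Replacement and Power Set speak of sets of [V], while names and functions are indexed by types.
    Coding a type injectively by a set carries the set axioms over to it. *)
Definition small_type (J : Type) : Prop :=
  exists2 c : J -> V, injective c & is_small (range c).

Lemma is_small_range (J : Type) (F : J -> V) :
  small_type J -> is_small (range F).
Proof.
move=> [c cI [D DE]].
have [|s sP] := @replacement_ax V (fun y z => exists2 j, c j = y & F j = z) D.
  by move=> y z z' _ [j cj <-] [j' cj' <-]; congr F; apply: cI; rewrite cj cj'.
exists s; rewrite predeqE => z; split.
  by move=> /sP[y _ [j _ <-]]; exists j.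
move=> [j _ <-]; apply/sP; exists (c j); last by exists j.
by rewrite -[_ ∈ D]/(ext_of D (c j)) DE; exists j.
Qed.

Lemma is_small_image (J : Type) (P : set J) (F : J -> V) :
  small_type J -> is_small (F @` P).
Proof.
move=> /(is_small_range F); apply: is_small_sub.
by move=> _ [j _ <-]; exists j.
Qed.

Lemma is_small_bigcup (J : Type) (P : J -> set V) :
  small_type J -> (forall j, is_small (P j)) ->
  is_small [set z | exists j, P j z].
Proof.
move=> sJ /choice[D DE]; have [R RE] := is_small_range D sJ.
have [u uP] := union_ax R; exists u; rewrite predeqE => z; split.
  move=> /uP[y]; rewrite -[_ ∈ R]/(ext_of R y) RE => -[j _ <-].
  by rewrite -[_ ∈ _]/(ext_of (D j) z) DE; exists j.
move=> [j Pjz]; apply/uP; exists (D j).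
  by rewrite -[_ ∈ R]/(ext_of R (D j)) RE; exists j.
by rewrite -[_ ∈ _]/(ext_of (D j) z) DE.
Qed.

Lemma small_type_inj (J K : Type) (f : J -> K) :
  injective f -> small_type K -> small_type J.
Proof.
move=> fI [c cI cs]; exists (c \o f); first exact: inj_comp.
by apply: is_small_sub cs => _ [j _ <-]; exists (f j).
Qed.

Lemma elt_inj x : injective (sval : elt x -> V).
Proof. by move=> [y yx] [z zx] /= e; exact: eq_exist. Qed.

Lemma small_type_elt x : small_type (elt x).
Proof.
exists sval; first exact: elt_inj.
by apply: is_small_sub (is_small_elt x) => _ [[y yx] _ <-].
Qed.

Lemma small_type_sig (J : Type) (P : J -> Prop) :
  small_type J -> small_type {j | P j}.
Proof.
by apply: (@small_type_inj _ _ sval) => -[y yx] [z zx] /= e; exact: eq_exist.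
Qed.

Lemma small_type_false : small_type False.
Proof.
exists (fun=> empty) => //.
by apply: is_small_sub (is_small_elt empty) => _ [[]].
Qed.

Lemma small_type_sigT (J : Type) (L : J -> Type) :
  small_type J -> (forall j, small_type (L j)) -> small_type {j & L j}.
Proof.
move=> sJ sL; have [c cI cs] := sJ.
have /all_sig[c' c'P] j : {c' : L j -> V | injective c'}.
  by apply: cid; have [c' ? _] := sL j; exists c'.
exists (fun u => opair (c (projT1 u)) (c' _ (projT2 u))).
  move=> [j l] [j' l'] /= /opair_inj[/cI jj']; subst j' => /c'P ll'.
  by rewrite ll'.
apply: (is_small_sub _ (@is_small_bigcup _
  (fun j => range (fun l : L j => opair (c j) (c' j l))) sJ _)).
  by move=> _ [[j l] _ <-]; exists j; exists l.
by move=> j; exact: is_small_range.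
Qed.

Lemma small_type_prod (J K : Type) :
  small_type J -> small_type K -> small_type (J * K).
Proof.
move=> sJ sK; have := small_type_sigT sJ (fun=> sK).
apply: (@small_type_inj _ _ (fun u => existT (fun=> K) u.1 u.2)).
move=> [j k] [j' k'] /= e; congr pair; first exact: (f_equal (@projT1 _ _) e).
exact: (f_equal (fun u : {_ : J & K} => projT2 u : K) e).
Qed.

Lemma small_type_set (J : Type) : small_type J -> small_type (set J).
Proof.
move=> sJ; have [c cI [D DE]] := sJ.
exists (fun S : set J => collect (c @` S)) => [P Q e|].
  have {}e : c @` P = c @` Q.
    by rewrite -(collectE (is_small_image P c sJ)) e collectE //; exact: is_small_image.
  have cS (S : set J) j : (c @` S) (c j) = S j.
    by rewrite propeqE; split=> [[i Si /cI <-]|Sj]//; exists j.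
  by apply/funext => j; rewrite -!cS e.
have [p pP] := powerset_ax D.
apply: is_small_sub (is_small_elt p) => _ [P _ <-]; apply/pP => w.
move/(in_collect _ (is_small_image P c sJ)) => [j _ <-].
by rewrite -[_ ∈ D]/(ext_of D (c j)) DE; exists j.
Qed.

Lemma small_type_fun (J K : Type) :
  small_type J -> small_type K -> small_type (J -> K).
Proof.
move=> sJ sK; have := small_type_set (small_type_prod sJ sK).
apply: (@small_type_inj _ _ (fun f => [set u | f u.1 = u.2])) => f g e.
apply/funext => j; symmetry.
by have : [set u | f u.1 = u.2] (j, f j) by []; rewrite e.
Qed.

(** Recursion along [E] produces a function satisfying the equation, so the one chosen by [collapse]
    satisfies it too. The points of [X] will be classes of names or of functions, which need not be
    sets; hence set-likeness is stated as a covering of the predecessors by a small type. *)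
Lemma collapseE (X : Type) (E : X -> X -> Prop) :
  well_founded E ->
  (forall c, exists2 J, small_type J &
     exists h : J -> X, forall d, E d c -> exists j, h j = d) ->
  forall c, ext_of (collapse V E c) =
            [set collapse V E d | d in [set d | E d c]].
Proof.
move=> Ewf Esl.
suff : exists p : X -> V,
    forall c, ext_of (p c) = [set p d | d in [set d | E d c]] by exact: theP.
pose p := Fix Ewf (fun=> V : Type)
  (fun c rec => collect [set z | exists d (dc : E d c), rec d dc = z]).
exists p => c.
have pE : p c = collect [set p d | d in [set d | E d c]].
  rewrite {1}/p Fix_eq; last first.
    move=> c' f g fg; congr collect; rewrite predeqE => z.
    by split=> -[d [dc <-]]; exists d, dc; rewrite fg.
  congr collect; rewrite predeqE => z; split; first by move=> [d [dc <-]]; exists d.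
  by move=> [d dc <-]; exists d, dc.
rewrite pE collectE //; have [J sJ [h hP]] := Esl c.
apply: is_small_sub (is_small_range (p \o h) sJ).
by move=> _ [d /hP[j <-] <-]; exists j.
Qed.

End Sets.

Local Notation "a ≤ b" := (Order.le a b) (at level 70, no associativity).
Local Notation "a ⊓ b" := (Order.meet a b) (at level 40, left associativity).
Local Notation "⊤" := Order.top.
Local Notation "⊥" := Order.bottom.

Ltac meet_sub :=
  first [ exact: lexx | exact: lex1 | assumption
        | apply: leIxl; meet_sub | apply: leIxr; meet_sub ].
Ltac meet_le :=
  repeat (rewrite lexI; apply/andP; split); solve [meet_sub].

(** * Infinite joins and meets in a complete Boolean algebra *)

Section CompleteBooleanAlgebra.
Variables (d : Order.disp_t) (B : ctbDistrLatticeType d).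
Hypothesis Bcomplete : is_complete B.
Implicit Types (A S : set B) (a b c x : B).

Lemma le_compl a b : (a ≤ Order.compl b) = (a ⊓ b == ⊥).
Proof. by rewrite Order.CTBDistrLatticeTheory.disj_leC. Qed.

Lemma le_bimp c a b : (c ≤ bimp a b) = (c ⊓ a ≤ b).
Proof.
rewrite /bimp; apply/idP/idP => h.
  have : c ⊓ a ≤ (Order.join (Order.compl a) b) ⊓ a by exact: leI2.
  by rewrite meetUl meetCx join0x; move/le_trans; apply; exact: leIl.
rewrite -[c]meetx1 -(joinxC a) meetUr leUx; apply/andP; split.
  by apply: (le_trans h); exact: leUr.
by apply: leIxr; exact: leUl.
Qed.

Lemma bsup_supremums S : supremums S (bsup S).
Proof.
(* On the empty set [supremum] returns its default value, and the default [⊥] is the correct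
   join. *)
rewrite /bsup /supremum; case: ifPn => [/eqP ->|_].
  by split=> [x []|x _]; exact: le0x.
by apply: xgetPex; exact: Bcomplete.
Qed.

Lemma le_bsup S a : S a -> a ≤ bsup S.
Proof. by move=> Sa; have [+ _] := bsup_supremums S; apply. Qed.

Lemma bsup_le S x : (forall a, S a -> a ≤ x) -> bsup S ≤ x.
Proof. by move=> Sx; have [_] := bsup_supremums S; apply. Qed.

(** Infinite distributivity, a consequence of the adjunction between meet and [bimp]. *)
Lemma meet_bsup_le S c x : (forall a, S a -> c ⊓ a ≤ x) -> c ⊓ bsup S ≤ x.
Proof.
by move=> Sx; rewrite meetC -le_bimp; apply: bsup_le => a Sa;
   rewrite le_bimp meetC; exact: Sx.
Qed.

Lemma binf_infimums S : infimums S (binf S).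
Proof.
have Sinf : infimums S (bsup (lbound S)).
  split; last by move=> x; exact: le_bsup.
  by move=> a Sa; apply: bsup_le => x; apply.
rewrite /binf /infimum; case: ifPn => [/eqP ->|_].
  by split=> [x []|x _]; exact: lex1.
by apply: xgetPex; exists (bsup (lbound S)).
Qed.

Lemma le_binf S x : (forall a, S a -> x ≤ a) -> x ≤ binf S.
Proof. by move=> Sx; have [_] := binf_infimums S; apply. Qed.

Lemma binf_le S a : S a -> binf S ≤ a.
Proof. by move=> Sa; have [+ _] := binf_infimums S; apply. Qed.

(** Infinite De Morgan law: the failure of a bounded universal statement yields a join of
    counterexamples, from which a name of a counterexample can be mixed. *)
Lemma compl_binf_bimp (J : Type) (f g : J -> B) :
  Order.compl (binf (range (fun j => bimp (f j) (g j)))) ≤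
  bsup (range (fun j => f j ⊓ Order.compl (g j))).
Proof.
rewrite leCx; apply: le_binf => _ [j _ <-].
rewrite le_bimp -[g j]complK le_compl -meetA -le_compl leC.
by apply: le_bsup; exists j.
Qed.

Definition disjoint_family (J : Type) (c : J -> B) :=
  forall i j, i <> j -> c i ⊓ c j = ⊥.

(* Along a well-order of [J], [p j] is [f j] minus the join of the earlier [f i]. *)
Lemma disjointify (J : Type) (f : J -> B) :
  exists p : J -> B, [/\ forall j, p j ≤ f j, disjoint_family p &
                         bsup (range f) ≤ bsup (range p)].
Proof.
have [R Rwo] := well_ordering_principle {classic J}.
have Rch : wo_chain R predT by move=> C _; exact: Rwo.
have Ranti : antisymmetric R.
  by move=> i j; exact: (wo_chain_antisymmetric Rch).
have Rtot : total R by move=> i j; exact: (wo_chainW Rch).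
pose p (j : J) := f j ⊓ Order.compl (bsup [set f i | i in [set i | R i j /\ i <> j]]).
exists p; split=> [j|i j ij|]; first exact: leIl.
  wlog Rij : i j ij / R i j.
    move=> W; have /orP[|Rji] : R i j || R j i by exact: Rtot.
      exact: W.
    by rewrite meetC; apply: W => // e; apply: ij.
  apply/eqP; rewrite -lex0.
  have fij : f i ≤ bsup [set f k | k in [set k | R k j /\ k <> j]].
    by apply: le_bsup; exists i.
  rewrite -(meetxC (f i)) lexI; apply/andP; split; first by rewrite /p; meet_le.
  apply: leIxr; rewrite /p; apply: leIxr.
  by rewrite leCx complK.
pose m := Order.compl (bsup (range p)).
(* If the join of the [p j] misses part of some [f j], take the least such [j]. That part is
   disjoint from all earlier [f i], hence below [p j], a contradiction. *)
have [j0|/existsNP[j0 fj0]] := EM (forall j, f j ⊓ m = ⊥).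
  apply: bsup_le => _ [j _ <-].
  by rewrite -[X in _ ≤ X]complK le_compl j0.
have [|j [[/asboolP fj jmin] _]] := Rwo [pred j : {classic J} | `[< f j ⊓ m <> ⊥ >]].
  by exists j0; apply/asboolP.
exfalso; apply: fj.
have pj : f j ⊓ m ≤ p j.
  rewrite /p lexI leIl /= le_compl -lex0; apply: meet_bsup_le => _ [i [Rij ij] <-].
  have -> : f j ⊓ m ⊓ f i = f j ⊓ (f i ⊓ m) by rewrite -meetA (meetC m).
  have [->|fi] := EM (f i ⊓ m = ⊥); first by rewrite meetx0.
  exfalso; apply: ij; apply: Ranti => //; rewrite Rij /=.
  by apply: jmin; apply/asboolP.
apply/eqP; rewrite -lex0 -(meetxC (bsup (range p))) lexI; apply/andP; split.
  by apply: (le_trans pj); apply: le_bsup; exists j.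
exact: leIr.
Qed.

End CompleteBooleanAlgebra.

(** * Boolean values of equality and membership, check names, and mixing *)

Section BooleanValues.
Variables (V : universe) (d : Order.disp_t) (B : ctbDistrLatticeType d).
Hypothesis Bcomplete : is_complete B.
Local Notation name := (name V B).
Implicit Types (σ τ ρ : name) (c : B) (x y : V).

Definition dom σ : V := let: @Name _ _ _ D _ _ := σ in D.

Definition sub σ : elt (dom σ) -> name :=
  let: @Name _ _ _ _ s _ := σ in s.

Definition wt σ : elt (dom σ) -> B :=
  let: @Name _ _ _ _ _ v := σ in v.

Lemma mem_valE ρ σ :
  mem_val ρ σ = bsup (range (fun i => wt i ⊓ eq_val ρ (sub (σ := σ) i))).
Proof. by case: σ. Qed.

(** Together with [mem_val_le], the introduction and elimination rules for Boolean-valued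
    membership; [c] acts as the context of a deduction. *)
Lemma le_mem_val ρ σ (i : elt (dom σ)) c :
  c ≤ wt i -> c ≤ eq_val ρ (sub i) -> c ≤ mem_val ρ σ.
Proof.
move=> ci cs; rewrite mem_valE.
apply: (@le_trans _ _ (wt i ⊓ eq_val ρ (sub i))); first by rewrite lexI ci.
by apply: le_bsup => //; exists i.
Qed.

Lemma mem_val_le ρ σ c (a : B) :
  (forall i : elt (dom σ), c ⊓ (wt i ⊓ eq_val ρ (sub i)) ≤ a) ->
  c ⊓ mem_val ρ σ ≤ a.
Proof.
by move=> h; rewrite mem_valE; apply: meet_bsup_le => // _ [i _ <-]; exact: h.
Qed.

Lemma eq_val_sym σ τ : eq_val σ τ = eq_val τ σ.
Proof.
elim: σ τ => D s IH v [E t w] /=; rewrite meetC; congr (_ ⊓ _);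
  congr binf; congr image; apply/funext => i; congr bimp; congr bsup;
  congr image; apply/funext => j; by rewrite IH.
Qed.

Lemma le_eq_sym c σ τ : c ≤ eq_val σ τ -> c ≤ eq_val τ σ.
Proof. by rewrite eq_val_sym. Qed.

Lemma le_eq_val σ τ c :
  (forall i : elt (dom σ), c ⊓ wt i ≤ mem_val (sub i) τ) ->
  (forall i : elt (dom τ), c ⊓ wt i ≤ mem_val (sub i) σ) ->
  c ≤ eq_val σ τ.
Proof.
case: σ => D s v; case: τ => E t w /= h1 h2; rewrite lexI; apply/andP; split.
  by apply: le_binf => // _ [i _ <-]; rewrite le_bimp; exact: h1.
apply: le_binf => // _ [i _ <-]; rewrite le_bimp; apply: (le_trans (h2 i)).
apply: bsup_le => // _ [k _ <-]; apply: le_bsup => //.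
by exists k => //; rewrite eq_val_sym.
Qed.

Lemma eq_val_le_mem σ τ (i : elt (dom σ)) :
  eq_val σ τ ⊓ wt i ≤ mem_val (sub i) τ.
Proof.
case: σ i => D s v; case: τ => E t w /= i.
by rewrite -le_bimp; apply: leIxl; apply: binf_le => //; exists i.
Qed.

Lemma eq_val_refl σ : eq_val σ σ = ⊤.
Proof.
apply/eqP; rewrite -le1x; elim: σ => D s IH v.
by apply: le_eq_val => /= i; rewrite meet1x; apply: (@le_mem_val _ (Name s v) i) => //=;
   apply: le_trans (IH i); exact: lex1.
Qed.

(** Each inclusion passes through a member of the middle name. The induction is on [σ] only; for the
    inclusion of [ρ] in [σ], symmetry turns the equalities around so that the same hypothesis [mid]
    applies. *)
Lemma eq_val_trans σ τ ρ : eq_val σ τ ⊓ eq_val τ ρ ≤ eq_val σ ρ.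
Proof.
elim: σ τ ρ => D s IH v τ ρ; set σ := Name s v.
have mid (c : B) (i : elt D) (k : elt (dom τ)) (l : elt (dom ρ)) :
    c ≤ eq_val (s i) (sub k) -> c ≤ eq_val (sub k) (sub l) ->
    c ≤ eq_val (s i) (sub l).
  by move=> h1 h2; apply: le_trans (IH i (sub k) (sub l)); rewrite lexI h1.
apply: le_eq_val => i.
  rewrite -[X in X ≤ _]meetxx.
  apply: (@le_trans _ _ (eq_val σ τ ⊓ eq_val τ ρ ⊓ wt i ⊓ mem_val (sub i) τ)).
    rewrite lexI leIl /=; apply: le_trans (eq_val_le_mem τ i); meet_le.
  apply: mem_val_le => k.
  apply: (@le_trans _ _ (wt k ⊓ eq_val (sub i) (sub k) ⊓ mem_val (sub k) ρ)).
    rewrite lexI; apply/andP; split; first by meet_le.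
    by apply: le_trans (eq_val_le_mem ρ k); meet_le.
  apply: mem_val_le => l; apply: (@le_mem_val _ _ l); first by meet_le.
  by apply: (@mid _ _ k); meet_le.
rewrite -[X in X ≤ _]meetxx.
apply: (@le_trans _ _ (eq_val σ τ ⊓ eq_val τ ρ ⊓ wt i ⊓ mem_val (sub i) τ)).
  rewrite lexI leIl /=; apply: le_trans (eq_val_le_mem τ i).
  by rewrite (eq_val_sym ρ); meet_le.
apply: mem_val_le => k.
apply: (@le_trans _ _ (wt k ⊓ eq_val (sub i) (sub k) ⊓ mem_val (sub k) σ)).
  rewrite lexI; apply/andP; split; first by meet_le.
  by apply: le_trans (eq_val_le_mem σ k); rewrite (eq_val_sym σ τ); meet_le.
apply: mem_val_le => l; apply: (@le_mem_val _ _ l); first by meet_le.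
by apply: le_eq_sym; apply: (@mid _ l k i); apply: le_eq_sym; meet_le.
Qed.

Lemma le_eq_trans τ c σ ρ :
  c ≤ eq_val σ τ -> c ≤ eq_val τ ρ -> c ≤ eq_val σ ρ.
Proof. by move=> h1 h2; apply: le_trans (eq_val_trans σ τ ρ); rewrite lexI h1. Qed.

Lemma le_eq_refl c σ : c ≤ eq_val σ σ.
Proof. by rewrite eq_val_refl lex1. Qed.

Lemma le_mem_eql ρ c ρ' σ :
  c ≤ eq_val ρ ρ' -> c ≤ mem_val ρ σ -> c ≤ mem_val ρ' σ.
Proof.
move=> h1 h2; apply: (@le_trans _ _ (c ⊓ mem_val ρ σ)); first by meet_le.
apply: mem_val_le => i; apply: (@le_mem_val _ _ i); first by meet_le.
by apply: (@le_eq_trans ρ); [apply: le_eq_sym; apply: leIxl|meet_le].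
Qed.

Lemma le_mem_eqr σ c ρ τ :
  c ≤ eq_val σ τ -> c ≤ mem_val ρ σ -> c ≤ mem_val ρ τ.
Proof.
move=> h1 h2; apply: (@le_trans _ _ (c ⊓ mem_val ρ σ)); first by meet_le.
apply: mem_val_le => i; apply: (@le_mem_eql (sub i)).
  by apply: le_eq_sym; meet_le.
apply: le_trans (eq_val_le_mem τ i); rewrite lexI; apply/andP; split; last by meet_le.
exact: leIxl.
Qed.

Lemma check_eq x : check B x = Name (fun y : elt x => check B (sval y)) (fun=> ⊤).
Proof.
rewrite {1}/check Fix_eq // => z f g fg; congr (Name _ _).
by apply/funext => -[y yz]; exact: fg.
Qed.

Lemma mem_val_check ρ x :
  mem_val ρ (check B x) = bsup [set eq_val ρ (check B y) | y in ext_of x].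
Proof.
rewrite check_eq /=; congr bsup; rewrite predeqE => b; split.
  by move=> [[y yx] _ <-] /=; exists y => //; rewrite meet1x.
by move=> [y yx <-]; exists (exist _ y yx) => //=; rewrite meet1x.
Qed.

Lemma mem_check_check x y : x ∈ y -> mem_val (check B x) (check B y) = ⊤.
Proof.
move=> xy; apply/eqP; rewrite -le1x mem_val_check -(eq_val_refl (check B x)).
by apply: le_bsup => //; exists x.
Qed.

(** Extensionality gives a [z] in only one of the two sets. Were the check names equal, [z] would be
    equal to a member of the other set, all of which differ from [z]; symmetry puts the member of
    [x] first, where the induction applies. *)
Lemma eq_check_check x y : x <> y -> eq_val (check B x) (check B y) = ⊥.
Proof.
elim/(well_founded_ind (smem_wf V)): x y => x IH y xy; apply/eqP; rewrite -lex0.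
have [/set_ext //|/existsNP[z]] := EM (forall z, z ∈ x <-> z ∈ y).
have [zx|zx] := EM (z ∈ x); have [zy|zy] := EM (z ∈ y); try by case; split.
  move=> _.
  have := @le_mem_eqr (check B x) (eq_val (check B x) (check B y)) (check B z) _ (lexx _).
  rewrite mem_check_check// => /(_ (lex1 _)) /le_trans; apply.
  rewrite mem_val_check; apply: bsup_le => // _ [w wy <-].
  by rewrite IH // => zw; apply: zy; rewrite zw.
move=> _.
have := @le_mem_eqr (check B y) (eq_val (check B x) (check B y)) (check B z) (check B x).
rewrite eq_val_sym mem_check_check// => /(_ (lexx _) (lex1 _)) /le_trans; apply.
rewrite mem_val_check; apply: bsup_le => // _ [w wy <-].
by rewrite eq_val_sym IH // => zw; apply: zx; rewrite -zw.
Qed.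

(** Names are indexed by the elements of a set, so the family is reindexed along the inverse of the
    coding of [J]. *)
Lemma name_of_family (J : Type) (s : J -> name) (v : J -> B) :
  small_type V J ->
  exists σ, forall ρ, mem_val ρ σ = bsup (range (fun j => v j ⊓ eq_val ρ (s j))).
Proof.
move=> [c cI [D DE]].
have /choice[q qP] : forall x : elt D, exists j, c j = sval x.
  move=> [x xD] /=; have : range c x by rewrite -DE.
  by move=> [j _ <-]; exists j.
exists (Name (s \o q) (v \o q)) => ρ /=; congr bsup; rewrite predeqE => b; split.
  by move=> [x _ <-]; exists (q x).
move=> [j _ <-].
have jD : c j ∈ D by rewrite -[_ ∈ _]/(ext_of D (c j)) DE; exists j.
by exists (exist _ (c j) jD) => //=; rewrite (cI _ _ (qP (exist _ (c j) jD))).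
Qed.

(** The mixture collects the members of all the [s j], with weights cut down to [c j]; by
    disjointness only those of [s j] count below [c j]. *)
Lemma mixing (J : Type) (c : J -> B) (s : J -> name) :
  small_type V J -> disjoint_family c ->
  exists σ, forall j, c j ≤ eq_val σ (s j).
Proof.
move=> sJ cdis.
have sK : small_type V {j : J & elt (dom (s j))}.
  by apply: small_type_sigT => // j; exact: small_type_elt.
have [σ σP] := name_of_family (fun u => sub (projT2 u))
                              (fun u => c (projT1 u) ⊓ wt (projT2 u)) sK.
exists σ => j; apply: le_eq_val => i.
  have : wt i ≤ mem_val (sub i) σ by apply: (@le_mem_val _ _ i) => //; exact: le_eq_refl.
  move=> /(leI2 (lexx (c j))) /le_trans; apply; rewrite σP.
  apply: meet_bsup_le => // _ [[j' k] _ <-] /=.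
  have [e|/cdis jj'] := EM (j = j').
    subst j'; apply: (@le_mem_eql (sub k)); last apply: (@le_mem_val _ _ k).
    - by apply: le_eq_sym; meet_le.
    - by meet_le.
    - exact: le_eq_refl.
  by rewrite !meetA jj' !meet0x le0x.
rewrite σP; apply: le_bsup => //; exists (existT _ j i) => //=.
by rewrite eq_val_refl meetx1.
Qed.

End BooleanValues.

(** * The quotient of the Boolean-valued universe by [U] and its transitive collapse *)

Section Quotient.
Variables (V : universe) (d : Order.disp_t) (B : ctbDistrLatticeType d).
Hypothesis Bcomplete : is_complete B.
Hypothesis Bsmall : small_type V B.
Variable U : set B.
Hypothesis Uultra : ultrafilter U.
Local Notation name := (name V B).
Implicit Types (σ τ ρ : name) (a b c : B) (x y : V).

Lemma ultra_top : U ⊤.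
Proof. by have [[]] := Uultra. Qed.

Lemma ultra_bot : ~ U ⊥.
Proof. by have [[]] := Uultra. Qed.

Lemma ultra_le a b : U a -> a ≤ b -> U b.
Proof. by have [_ + _ _] := Uultra; apply. Qed.

Lemma ultra_meet a b : U a -> U b -> U (a ⊓ b).
Proof. by have [_ _ + _] := Uultra; apply. Qed.

Lemma ultra_compl a : ~ U a <-> U (Order.compl a).
Proof.
split; first by have [_ _ _ /(_ a)[]] := Uultra.
by move=> Uca Ua; apply: ultra_bot; rewrite -(meetxC a); exact: ultra_meet.
Qed.

Lemma ultra_eq_refl σ : U (eq_val σ σ).
Proof. by rewrite eq_val_refl //; exact: ultra_top. Qed.

Lemma ultra_eq_sym σ τ : U (eq_val σ τ) -> U (eq_val τ σ).
Proof. by rewrite eq_val_sym. Qed.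

Lemma ultra_eq_trans τ σ ρ : U (eq_val σ τ) -> U (eq_val τ ρ) -> U (eq_val σ ρ).
Proof.
move=> h1 h2; apply: ultra_le (ultra_meet h1 h2) _.
by apply: (le_eq_trans Bcomplete (τ := τ)) => //; meet_le.
Qed.

Lemma ultra_mem_eql ρ ρ' σ : U (eq_val ρ ρ') -> U (mem_val ρ σ) -> U (mem_val ρ' σ).
Proof.
move=> h1 h2; apply: ultra_le (ultra_meet h1 h2) _.
by apply: (le_mem_eql Bcomplete (ρ := ρ)) => //; meet_le.
Qed.

Lemma ultra_mem_eqr σ τ ρ : U (eq_val σ τ) -> U (mem_val ρ σ) -> U (mem_val ρ τ).
Proof.
move=> h1 h2; apply: ultra_le (ultra_meet h1 h2) _.
by apply: (le_mem_eqr Bcomplete (σ := σ)) => //; meet_le.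
Qed.

Lemma name_class_eq σ τ : name_class U σ = name_class U τ <-> U (eq_val σ τ).
Proof.
split=> [e|h].
  by have : name_class U τ τ by [exact: ultra_eq_refl]; rewrite -e.
rewrite predeqE => ρ; rewrite /name_class /=; split; apply: ultra_eq_trans => //.
exact: ultra_eq_sym.
Qed.

Lemma name_memE σ τ :
  name_mem U (name_class U σ) (name_class U τ) <-> U (mem_val σ τ).
Proof.
split; last by move=> h; exists σ, τ.
move=> [σ' [τ' [/name_class_eq/ultra_eq_sym h1 /name_class_eq/ultra_eq_sym h2 h]]].
by apply: ultra_mem_eql h1 _; exact: ultra_mem_eqr h2 _.
Qed.

(** The class of a member [ρ] of [σ] is determined by the function [k |-> eq_val ρ (sub k)] on the
    domain of [σ]: another member with the same function equals [ρ] with value at least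
    [mem_val ρ σ]. There is only a set of such functions. *)
Lemma name_mem_small (C : set name) : exists2 J, small_type V J &
  exists h : J -> set name, forall D, name_mem U D C -> exists j, h j = D.
Proof.
have [[σ ->]|nC] := EM (exists σ, C = name_class U σ); last first.
  exists False; first exact: small_type_false.
  exists (fun=> set0) => D [σ [τ [_ Cτ _]]].
  by exfalso; apply: nC; exists τ.
exists (elt (dom σ) -> B).
  by apply: small_type_fun => //; exact: small_type_elt.
pose P (j : elt (dom σ) -> B) ρ :=
  (forall k, eq_val ρ (sub k) = j k) /\ U (mem_val ρ σ).
exists (fun j => [set τ | exists ρ, P j ρ /\ name_class U ρ τ]).
move=> D [ρ [σ' [-> /name_class_eq /ultra_eq_sym h /(ultra_mem_eqr h) Uρ]]].
exists (fun k => eq_val ρ (sub k)).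
rewrite predeqE => τ; split; last by move=> h'; exists ρ.
move=> [ρ' [[ρ'k Uρ'] ρ't]]; apply: ultra_eq_trans _ ρ't.
apply: ultra_le Uρ _; rewrite -[X in X ≤ _]meet1x; apply: mem_val_le => // k.
apply: (le_eq_trans Bcomplete (τ := sub k)) => //; first by meet_le.
by apply: le_eq_sym; rewrite ρ'k; meet_le.
Qed.

(* The maximum principle of the Boolean-valued universe. *)
Lemma ultra_mixing (J : Type) (c : J -> B) (s : J -> name) :
  small_type V J -> U (bsup (range c)) ->
  exists σ (p : J -> B), [/\ forall j, p j ≤ c j, disjoint_family p,
    U (bsup (range p)) & forall j, p j ≤ eq_val σ (s j)].
Proof.
move=> sJ Uc; have [p [pc pd cp]] := disjointify Bcomplete c.
have [σ σP] := mixing Bcomplete s sJ pd.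
by exists σ, p; split=> //; exact: ultra_le Uc _.
Qed.

(** If the inclusion failed modulo [U], the members of [σ] could be mixed along the values of their
    being counterexamples, giving a name that is in [σ] but not in [τ]. *)
Lemma ultra_ext_half σ τ : (forall ρ, U (mem_val ρ σ) -> U (mem_val ρ τ)) ->
  U (binf (range (fun i : elt (dom σ) => bimp (wt i) (mem_val (sub i) τ)))).
Proof.
move=> h; apply: contrapT => /ultra_compl /ultra_le/(_ (compl_binf_bimp Bcomplete _ _)).
move=> /(ultra_mixing (fun i => sub i) (small_type_elt _))[ρ [p [pc _ Up pe]]].
have pi (i : elt (dom σ)) : p i ≤ wt i.
  by apply: le_trans (pc i) _; exact: leIl.
have /h/ultra_meet : U (mem_val ρ σ).
  apply: ultra_le Up _; apply: bsup_le => // _ [i _ <-].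
  exact: (@le_mem_val _ _ _ _ _ _ i).
have : U (Order.compl (mem_val ρ τ)).
  apply: ultra_le Up _; apply: bsup_le => // _ [i _ <-].
  rewrite le_compl -lex0 -(meetCx (mem_val (sub i) τ)) lexI; apply/andP; split.
    by apply: leIxl; apply: le_trans (pc i) _; exact: leIr.
  apply: (le_mem_eql Bcomplete (ρ := ρ)) => //; last exact: leIr.
  exact: leIxl.
by move=> /[swap] /[apply]; rewrite meetxC; exact: ultra_bot.
Qed.

Lemma ultra_ext σ τ :
  (forall ρ, U (mem_val ρ σ) <-> U (mem_val ρ τ)) -> U (eq_val σ τ).
Proof.
move=> h; have h1 := ultra_ext_half (fun ρ => (h ρ).1).
have h2 := ultra_ext_half (fun ρ => (h ρ).2).
apply: ultra_le (ultra_meet h1 h2) _; apply: le_eq_val => // i; rewrite -le_bimp.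
  by apply: leIxl; apply: binf_le => //; exists i.
by apply: leIxr; apply: binf_le => //; exists i.
Qed.

Hypothesis Uwf : well_founded_VBU V U.

Lemma in_eval x σ : x ∈ eval U σ <-> exists2 ρ, U (mem_val ρ σ) & eval U ρ = x.
Proof.
rewrite -[_ ∈ _]/(ext_of (eval U σ) x) /eval collapseE //; last exact: name_mem_small.
split=> [[_ [ρ [τ [-> /name_class_eq/ultra_eq_sym στ h]]] <-]|[ρ h <-]].
  by exists ρ => //; exact: ultra_mem_eqr στ h.
by exists (name_class U ρ) => //; exists ρ, σ.
Qed.

(** The quotient is extensional by [ultra_ext], so its collapse is injective, by induction along
    membership. *)
Lemma eval_inj σ τ : eval U σ = eval U τ <-> U (eq_val σ τ).
Proof.
split; last by move/name_class_eq; rewrite /eval => ->.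
have [C eC] : exists C, C = name_class U σ by exists (name_class U σ).
elim/(well_founded_ind Uwf): C σ τ eC => C IH σ τ eC e; apply: ultra_ext => ρ.
split=> h.
  have /in_eval[ρ' h' e'] : eval U ρ ∈ eval U τ by rewrite -e; apply/in_eval; exists ρ.
  apply: (ultra_mem_eql _ h'); apply: ultra_eq_sym; apply: IH _ erefl (esym e').
  by rewrite eC; apply/name_memE.
have /in_eval[ρ' h' e'] : eval U ρ ∈ eval U σ by rewrite e; apply/in_eval; exists ρ.
apply: (ultra_mem_eql _ h'); apply: IH _ erefl e'.
by rewrite eC; apply/name_memE.
Qed.

Lemma eval_mem σ τ : eval U σ ∈ eval U τ <-> U (mem_val σ τ).
Proof.
split; last by move=> h; apply/in_eval; exists σ.
by move=> /in_eval[ρ h /eval_inj h']; exact: ultra_mem_eql h' h.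
Qed.

End Quotient.

(** * The ultrapower of the universe by [U_A] and Łoś's theorem for atomic formulas *)

Section Ultrapower.
Variables (V : universe) (d : Order.disp_t) (B : ctbDistrLatticeType d).
Hypothesis Bcomplete : is_complete B.
Hypothesis Bsmall : small_type V B.
Variables (U A : set B).
Hypothesis Uultra : ultrafilter U.
Hypothesis Uwf : well_founded_VBU V U.
Hypothesis Amax : maximal_antichain A.
Local Notation name := (name V B).
Implicit Types (σ τ ρ : name) (a b c : B) (x y : V) (f g : B -> V).
Implicit Types (P Q : B -> Prop).

Lemma antichain_disjoint a b : A a -> A b -> a <> b -> a ⊓ b = ⊥.
Proof. by move=> Aa Ab; have [[_ +] _] := Amax; apply. Qed.

(** The join of [A] is [⊤]: otherwise its complement could be added to [A], against maximality.
    Inequalities can therefore be checked below each member of [A] separately. *)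
Lemma le_antichain b c : (forall a, A a -> a ⊓ b ≤ c) -> b ≤ c.
Proof.
move=> h; have -> : b = b ⊓ bsup A.
  suff -> : bsup A = ⊤ by rewrite meetx1.
  apply: contrapT => nA; pose m := Order.compl (bsup A).
  have m0 : m <> ⊥ by move=> e; apply: nA; rewrite -[bsup A]complK -/m e compl0.
  have mA a : A a -> m ⊓ a = ⊥.
    move=> Aa; apply/eqP; rewrite -lex0 -(meetCx (bsup A)); apply: leI2 => //.
    exact: le_bsup.
  have [[A0 AA] maxA] := Amax.
  have mAm : A m.
    rewrite -[A](maxA (A `|` [set m])); first by right.
      split=> [a [/A0 //|->//]|a a' [Aa|->] [Aa'|->] //].
      - exact: AA.
      - by rewrite meetC mA.
      - by rewrite mA.
    by move=> a Aa; left.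
  by apply: m0; rewrite -(mA m mAm) meetxx.
by apply: meet_bsup_le => // a Aa; rewrite meetC; exact: h.
Qed.

Lemma antichain_mixing (s : B -> name) :
  exists σ, forall a, A a -> a ≤ eq_val σ (s a).
Proof.
(* The value [⊥] off [A] makes this a disjoint family over all of [B]. *)
pose c a : B := if pselect (A a) then a else ⊥.
have cd : disjoint_family c.
  move=> a b ab; rewrite /c; case: pselect => Aa; last by rewrite meet0x.
  by case: pselect => Ab; [exact: antichain_disjoint|rewrite meetx0].
have [σ σP] := mixing Bcomplete s Bsmall cd.
by exists σ => a Aa; have := σP a; rewrite /c; case: pselect.
Qed.

(** Membership in [U_A], read as an almost-everywhere quantifier over [A]. *)
Definition ae P : Prop := U (bsup [set a | A a /\ P a]).

Lemma UA_ae P : UA U A [set a | A a /\ P a] <-> ae P.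
Proof. by split=> [[]|] // h; split=> // a []. Qed.

Lemma ae_ultra P b : ae P -> (forall a, A a -> P a -> a ≤ b) -> U b.
Proof.
by move=> h Pb; apply: (ultra_le Uultra h); apply: bsup_le => // a []; exact: Pb.
Qed.

Lemma ultra_ae P b : U b -> (forall a, A a -> ~ P a -> a ⊓ b = ⊥) -> ae P.
Proof.
move=> Ub Pb; apply: (ultra_le Uultra Ub); apply: le_antichain => a Aa.
have [Pa|/Pb ->//] := EM (P a).
by apply: leIxl; apply: le_bsup.
Qed.

Lemma ae_mono P Q : ae P -> (forall a, A a -> P a -> Q a) -> ae Q.
Proof.
move=> h PQ; apply: (ae_ultra h) => a Aa Pa.
by apply: le_bsup => //; split=> //; exact: PQ.
Qed.

Lemma ae_all P : (forall a, A a -> P a) -> ae P.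
Proof. by move=> h; apply: ultra_ae (ultra_top Uultra) _ => a /h. Qed.

Lemma ae_and P Q : ae P -> ae Q -> ae (fun a => P a /\ Q a).
Proof.
move=> hP hQ; apply: ultra_ae (ultra_meet Uultra hP hQ) _ => a Aa /not_andP nPQ.
have dis R : ~ R a -> a ⊓ bsup [set a | A a /\ R a] = ⊥.
  move=> nR; apply/eqP; rewrite -lex0; apply: meet_bsup_le => // b [Ab Rb].
  by rewrite antichain_disjoint // => ab; apply: nR; rewrite ab.
by case: nPQ => /dis h; [rewrite meetA h meet0x|rewrite meetCA h meetx0].
Qed.

Lemma ae_mono2 P1 P2 Q : ae P1 -> ae P2 ->
  (forall a, A a -> P1 a -> P2 a -> Q a) -> ae Q.
Proof. by move=> h1 h2 h; apply: (ae_mono (ae_and h1 h2)) => a Aa []; exact: h. Qed.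

Lemma ae_false P : ae P -> (forall a, A a -> ~ P a) -> False.
Proof.
move=> h nP; apply: (ultra_bot Uultra); apply: ae_ultra h _ => a Aa /nP; exact.
Qed.

Lemma ae_not P : ~ ae P -> ae (fun a => ~ P a).
Proof.
move=> /(ultra_compl Uultra) h; apply: ultra_ae h _ => a Aa /contrapT Pa.
by apply/eqP; rewrite -le_compl complK; apply: le_bsup.
Qed.

Lemma ae_or P Q : ae (fun a => P a \/ Q a) -> ae P \/ ae Q.
Proof.
move=> h; have [|/ae_not nP] := EM (ae P); [by left|right].
by apply: ae_mono2 h nP _ => a _ [].
Qed.

Lemma fun_class_eq f g : fun_class U A f = fun_class U A g <-> ae (fun a => f a = g a).
Proof.
split=> [e|h].
  have : fun_class U A g g by apply/UA_ae; exact: ae_all.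
  by rewrite -e => /UA_ae.
rewrite predeqE => k; split=> /UA_ae h'; apply/UA_ae.
  by apply: ae_mono2 h h' _ => a _ ->.
by apply: ae_mono2 h h' _ => a _ ->.
Qed.

Lemma fun_memE f g :
  fun_mem U A (fun_class U A f) (fun_class U A g) <-> ae (fun a => f a ∈ g a).
Proof.
split; last by move=> h; exists f, g; split=> //; apply/UA_ae.
move=> [f' [g' [/fun_class_eq hf /fun_class_eq hg /UA_ae h]]].
by apply: ae_mono2 (ae_and hf hg) h _ => a _ [-> ->].
Qed.

(** Sending [f] to the mixture of the names [check B (f a)] along [A] preserves membership into the
    quotient by [U], so well-foundedness is inherited from there. *)
Lemma fun_mem_wf : well_founded (@fun_mem V d B U A).
Proof.
have acc f : Acc (fun_mem U A) (fun_class U A f).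
  have [σ σf] := antichain_mixing (check B \o f).
  have [C eC] : exists C, C = name_class U σ by exists (name_class U σ).
  elim/(well_founded_ind Uwf): C f σ σf eC => C IH f σ σf eC.
  constructor => _ [g [f' [-> /fun_class_eq ff' /UA_ae gf']]].
  have {f' ff' gf'} h : ae (fun a => g a ∈ f a).
    by apply: ae_mono2 ff' gf' _ => a _ ->.
  have [τ τg] := antichain_mixing (check B \o g).
  apply: (IH _ _ g τ) => //; rewrite eC; apply/name_memE => //.
  apply: ae_ultra h _ => a Aa fga.
  apply: (le_mem_eqr Bcomplete (σ := check B (f a))).
    by apply: le_eq_sym; exact: σf.
  apply: (le_mem_eql Bcomplete (ρ := check B (g a))).
    by apply: le_eq_sym; exact: τg.
  by rewrite mem_check_check // lex1.
move=> C; have [[f ->]|nC] := EM (exists f, C = fun_class U A f); first exact: acc.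
by constructor => D [f [g [_ Cg _]]]; exfalso; apply: nC; exists g.
Qed.

Lemma fun_mem_small (C : set (B -> V)) : exists2 J, small_type V J &
  exists h : J -> set (B -> V), forall D, fun_mem U A D C -> exists j, h j = D.
Proof.
have [[f ->]|nC] := EM (exists f, C = fun_class U A f); last first.
  exists False; first exact: small_type_false.
  exists (fun=> set0) => D [g [f [_ Cf _]]].
  by exfalso; apply: nC; exists f.
(* Members of the class of [f] have representatives with values in the union of the [f b]; [empty]
   is added as a default for arguments where the membership fails. *)
have [u uP] : is_small [set z | exists b, z = empty \/ z ∈ f b].
  apply: is_small_bigcup => // b.
  have [s sP] := is_small_upair (f b) (upair empty empty).
  have [t tP] := union_ax s; exists t; rewrite predeqE => z; split.
    move=> /tP[y]; rewrite -[y ∈ s]/(ext_of s y) sP => -[->|->]; first by right.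
    by move=> /in_upair[]; left.
  move=> h; apply/tP; case: h => [->|zf].
    exists (upair empty empty); last by apply/in_upair; left.
    by rewrite -[_ ∈ s]/(ext_of s _) sP; right.
  by exists (f b) => //; rewrite -[_ ∈ s]/(ext_of s _) sP; left.
exists (B -> elt u).
  by apply: small_type_fun => //; exact: small_type_elt.
exists (fun j => fun_class U A (fun b => sval (j b))).
move=> D [g [f' [-> /fun_class_eq ff' /UA_ae gf']]].
have h : ae (fun a => g a ∈ f a) by apply: ae_mono2 ff' gf' _ => a _ ->.
have in_u (z : V) : z ∈ u <-> exists b, z = empty \/ z ∈ f b.
  by rewrite -[_ ∈ u]/(ext_of u z) uP.
have /choice[j jP] : forall b, exists z : elt u, g b ∈ f b -> sval z = g b.
  move=> b; have [gb|ngb] := EM (g b ∈ f b).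
    have gu : g b ∈ u by apply/in_u; exists b; right.
    by exists (exist _ (g b) gu).
  have eu : empty ∈ u by apply/in_u; exists b; left.
  by exists (exist _ empty eu).
by exists j; apply/fun_class_eq; apply: ae_mono h _ => a _ /jP.
Qed.

Lemma in_fun_eval x g :
  x ∈ fun_eval U A g <-> exists2 f, ae (fun a => f a ∈ g a) & fun_eval U A f = x.
Proof.
rewrite -[_ ∈ _]/(ext_of (fun_eval U A g) x) /fun_eval collapseE; first last.
- exact: fun_mem_small.
- exact: fun_mem_wf.
split=> [[_ [f [g' [-> /fun_class_eq gg' /UA_ae h]]] <-]|[f h <-]].
  by exists f => //; apply: ae_mono2 gg' h _ => a _ ->.
by exists (fun_class U A f) => //; apply/fun_memE.
Qed.

Lemma fun_eval_inj f g : fun_eval U A f = fun_eval U A g <-> ae (fun a => f a = g a).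
Proof.
split; last by move/fun_class_eq; rewrite /fun_eval => ->.
have [C eC] : exists C, C = fun_class U A f by exists (fun_class U A f).
elim/(well_founded_ind fun_mem_wf): C f g eC => C IH f g eC e.
apply: contrapT => /ae_not h.
have /ae_or[{}h|{}h] : ae (fun a => (exists2 z, z ∈ f a & ~ z ∈ g a) \/
                            (exists2 z, z ∈ g a & ~ z ∈ f a)).
  apply: ae_mono h _ => a _; apply: contra_notP => /not_orP[h1 h2].
  apply: set_ext => z; split=> hz; apply: contrapT => hz'.
    by apply: h1; exists z.
  by apply: h2; exists z.
- have [k kP] := choice_in (P := fun a => exists2 z, z ∈ f a & ~ z ∈ g a) empty
    (fun a h => let: ex_intro2 z h1 h2 := h in ex_intro _ z (conj h1 h2)).
  have : fun_eval U A k ∈ fun_eval U A f.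
    by apply/in_fun_eval; exists k => //; apply: ae_mono h _ => a _ /kP[].
  rewrite e => /in_fun_eval[k' k'g k'k].
  have : ae (fun a => k a = k' a).
    apply: (IH (fun_class U A k)) => //; rewrite eC; apply/fun_memE.
    by apply: ae_mono h _ => a _ /kP[].
  move=> /ae_and/(_ (ae_and k'g h)) /ae_false; apply => a _ [kk' [k'ga /kP[]]].
  by rewrite kk'.
- have [k kP] := choice_in (P := fun a => exists2 z, z ∈ g a & ~ z ∈ f a) empty
    (fun a h => let: ex_intro2 z h1 h2 := h in ex_intro _ z (conj h1 h2)).
  have : fun_eval U A k ∈ fun_eval U A g.
    by apply/in_fun_eval; exists k => //; apply: ae_mono h _ => a _ /kP[].
  rewrite -e => /in_fun_eval[k' k'f k'k].
  have : ae (fun a => k' a = k a).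
    by apply: (IH (fun_class U A k')) => //; rewrite eC; apply/fun_memE.
  move=> /ae_and/(_ (ae_and k'f h)) /ae_false; apply => a _ [kk' [k'fa /kP[]]].
  by rewrite -kk'.
Qed.

Lemma fun_eval_mem f g : fun_eval U A f ∈ fun_eval U A g <-> ae (fun a => f a ∈ g a).
Proof.
split; last by move=> h; apply/in_fun_eval; exists f.
by move=> /in_fun_eval[k h /fun_eval_inj h']; apply: ae_mono2 h h' _ => a _ + <-.
Qed.

End Ultrapower.

(** * The embedding [j], the generic filter, and the limit maps from the ultrapowers *)

Section Embedding.
Variables (V : universe) (d : Order.disp_t) (B : ctbDistrLatticeType d).
Hypothesis Bcomplete : is_complete B.
Variable code : B -> V.
Hypothesis code_inj : injective code.
Hypothesis code_small : is_small (range code).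
Variable U : set B.
Hypothesis Uultra : ultrafilter U.
Hypothesis Uwf : well_founded_VBU V U.
Local Notation name := (name V B).
Implicit Types (σ τ ρ π ω : name) (a b c : B) (x y z : V) (f g : B -> V).

Let Bsmall : small_type V B.
Proof. by exists code. Qed.

Lemma decodeK : cancel code (decode code).
Proof.
move=> b; apply: code_inj; rewrite /decode.
by apply: (@theP _ _ [set b' | code b' = code b]); exists b.
Qed.

Lemma in_code_set (A : set B) z : z ∈ code_set code A <-> exists2 a, A a & code a = z.
Proof. exact: (in_collect _ (is_small_image A code Bsmall)). Qed.

Lemma code_set_inj : injective (code_set code).
Proof.
move=> A A' e; rewrite predeqE => b.
have h (S : set B) : S b <-> code b ∈ code_set code S.
  by split=> [Sb|/in_code_set[b' Sb' /code_inj <-]//]; apply/in_code_set; exists b.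
by rewrite h e -h.
Qed.

Lemma in_graph (A : set B) f z :
  z ∈ graph code A f <-> exists2 a, A a & opair (code a) (f a) = z.
Proof. exact: (in_collect _ (is_small_image A _ Bsmall)). Qed.

(** Check names of distinct codes are equal with value [⊥], so only the term of [b] itself
    contributes to the join. *)
Lemma mem_generic_name b : mem_val (check B (code b)) (generic_name code) = b.
Proof.
apply/eqP; rewrite eq_le; apply/andP; split.
  rewrite -[X in X ≤ _]meet1x; apply: mem_val_le => // -[x xB] /=.
  have /in_code_set[b' _ bx] := xB.
  have [->|bb'] := EM (b = b'); first by rewrite -bx decodeK; meet_le.
  by rewrite -bx eq_check_check ?meetx0 ?le0x // => /code_inj.
have bD : code b ∈ code_set code setT by apply/in_code_set; exists b.
apply: (@le_mem_val _ _ _ Bcomplete _ (generic_name code) (exist _ (code b) bD)) => /=.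
  by rewrite decodeK.
exact: le_eq_refl.
Qed.

Lemma le_eq_val_mem σ τ c :
  (forall ρ, c ⊓ mem_val ρ σ ≤ mem_val ρ τ) ->
  (forall ρ, c ⊓ mem_val ρ τ ≤ mem_val ρ σ) -> c ≤ eq_val σ τ.
Proof.
have wt_mem ρ (i : elt (dom ρ)) : wt i ≤ mem_val (sub i) ρ.
  by apply: (@le_mem_val _ _ _ _ _ _ i) => //; exact: le_eq_refl.
move=> h1 h2; apply: le_eq_val => // i.
  by apply: le_trans (h1 _); apply: leI2.
by apply: le_trans (h2 _); apply: leI2.
Qed.

(** A condition on Boolean values rather than a construction, so that check names of pairs satisfy
    it as well and [le_pair_name] can compare them with the names built by [pair_name_ex]. *)
Definition pair_name σ τ π : Prop :=
  forall ρ, mem_val ρ π = Order.join (eq_val ρ σ) (eq_val ρ τ).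

Lemma pair_name_ex σ τ : exists π, pair_name σ τ π.
Proof.
have sb : small_type V bool.
  (* The booleans are coded by [⊤] and [⊥], which differ because [U] is proper. *)
  apply: (@small_type_inj _ _ _ (fun b : bool => if b then ⊤ else ⊥) _ Bsmall).
  have TB : (⊤ : B) <> ⊥.
    by move=> e; apply: (ultra_bot Uultra); rewrite -e; exact: ultra_top.
  by move=> [] [] //= e; exfalso; apply: TB; rewrite e.
have [π πP] := name_of_family (fun b : bool => if b then σ else τ) (fun=> ⊤) sb.
exists π => ρ; rewrite πP; apply/eqP; rewrite eq_le; apply/andP; split.
  by apply: bsup_le => // _ [[] _ <-]; rewrite meet1x; [exact: leUl|exact: leUr].
by rewrite leUx; apply/andP; split; rewrite -[X in X ≤ _]meet1x; apply: le_bsup => //;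
   [exists true|exists false].
Qed.

Lemma pair_name_eval σ τ π :
  pair_name σ τ π -> eval U π = upair (eval U σ) (eval U τ).
Proof.
move=> πP; apply: set_ext => z; split.
  move=> /in_eval-/(_ Bcomplete Bsmall Uultra Uwf)[ρ + <-]; rewrite πP => Uρ.
  apply/in_upair; have [h|/(ultra_compl Uultra) h] := EM (U (eq_val ρ σ)).
    by left; apply/eval_inj.
  right; apply/eval_inj => //; apply: (ultra_le Uultra (ultra_meet Uultra Uρ h)).
  by rewrite meetUl meetxC join0x; meet_le.
move=> /in_upair[->|->]; apply/eval_mem => //; rewrite πP;
  apply: (ultra_le Uultra (ultra_top Uultra)); rewrite eq_val_refl //.
  exact: leUl.
exact: leUr.
Qed.

Lemma pair_name_check x y : pair_name (check B x) (check B y) (check B (upair x y)).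
Proof.
move=> ρ; rewrite mem_val_check; apply/eqP; rewrite eq_le; apply/andP; split.
  by apply: bsup_le => // _ [z /in_upair[->|->] <-]; [exact: leUl|exact: leUr].
by rewrite leUx; apply/andP; split; apply: le_bsup => //;
   [exists x => //; apply/in_upair; left|exists y => //; apply/in_upair; right].
Qed.

Lemma le_pair_name σ τ π σ' τ' π' c :
  pair_name σ τ π -> pair_name σ' τ' π' ->
  c ≤ eq_val σ σ' -> c ≤ eq_val τ τ' -> c ≤ eq_val π π'.
Proof.
move=> πP πP' h1 h2; apply: le_eq_val_mem => ρ; rewrite πP πP' meetUr leUx;
  apply/andP; split.
- by apply: lexUl; apply: (le_eq_trans Bcomplete (τ := σ)); [|apply: leIxl]; meet_le.
- by apply: lexUr; apply: (le_eq_trans Bcomplete (τ := τ)); [|apply: leIxl]; meet_le.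
- apply: lexUl; apply: (le_eq_trans Bcomplete (τ := σ')); first by meet_le.
  by apply: leIxl; exact: le_eq_sym.
- apply: lexUr; apply: (le_eq_trans Bcomplete (τ := τ')); first by meet_le.
  by apply: leIxl; exact: le_eq_sym.
Qed.

Lemma opair_name σ τ : exists2 ω, eval U ω = opair (eval U σ) (eval U τ) &
  forall c x y, c ≤ eq_val σ (check B x) -> c ≤ eq_val τ (check B y) ->
    c ≤ eq_val ω (check B (opair x y)).
Proof.
have [π πP] := pair_name_ex σ σ; have [π' π'P] := pair_name_ex σ τ.
have [ω ωP] := pair_name_ex π π'; exists ω.
  by rewrite (pair_name_eval ωP) (pair_name_eval πP) (pair_name_eval π'P).
move=> c x y h1 h2; apply: (le_pair_name ωP (pair_name_check _ _)).
  exact: (le_pair_name πP (pair_name_check _ _)).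
exact: (le_pair_name π'P (pair_name_check _ _)).
Qed.

Section Antichain.
Variable A : set B.
Hypothesis Amax : maximal_antichain A.

Lemma le_mem_check c σ x y : x ∈ y -> c ≤ eq_val σ (check B x) ->
  c ≤ mem_val σ (check B y).
Proof.
by move=> xy /le_trans; apply; rewrite mem_val_check; apply: le_bsup => //; exists x.
Qed.

Lemma ultra_antichain b : (forall a, A a -> a ≤ b) -> U b.
Proof.
move=> h; apply: (ultra_le Uultra (ultra_top Uultra)).
by apply: (le_antichain Bcomplete Amax) => a Aa; rewrite meetx1; exact: h.
Qed.

(** The values of a name being equal to the various elements of [x] join to an element of [U];
    making them disjoint gives the pieces [p]. *)
Lemma in_jmap_image (F : B -> V) x z :
  (forall y, y ∈ x <-> exists2 a, A a & F a = y) -> z ∈ jmap U x ->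
  exists ρ (p : {a | A a} -> B), [/\ eval U ρ = z, disjoint_family p,
    U (bsup (range p)) & forall a : {a | A a}, p a ≤ eq_val ρ (check B (F (sval a)))].
Proof.
move=> xF /in_eval-/(_ Bcomplete Bsmall Uultra Uwf)[ρ Uρ <-].
have [p [pc pd cp]] :=
  disjointify Bcomplete (fun a : {a | A a} => eq_val ρ (check B (F (sval a)))).
exists ρ, p; split=> //; apply: (ultra_le Uultra Uρ); apply: le_trans cp.
rewrite mem_val_check; apply: bsup_le => // _ [y /xF[a Aa <-] <-].
by apply: le_bsup => //; exists (exist _ a Aa).
Qed.

(** The mixture of the codes along [A] lies in both [j(A)] and [G]. It is the only such element:
    where a name equals [check B (code a)], its membership in [G] has value at most [a], and below
    [a] the mixture is the same check name. *)
Lemma bA_eval σ : (forall a, A a -> a ≤ eq_val σ (check B (code a))) ->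
  bA code U A = eval U σ.
Proof.
move=> σA.
have [|+ /in_eval] := @theP V empty
    [set x | x ∈ jmap U (code_set code A) /\ x ∈ generic code U].
  exists (eval U σ); split.
    apply/eval_mem => //; apply: ultra_antichain => a Aa.
    by apply: le_mem_check (σA a Aa); apply/in_code_set; exists a.
  apply/eval_mem => //; apply: ultra_antichain => a Aa.
  apply: (le_mem_eql Bcomplete (ρ := check B (code a))); first exact/le_eq_sym/σA.
  by rewrite mem_generic_name.
rewrite -/(bA code U A).
move=> /(in_jmap_image (in_code_set A))[ρ [p [<- _ Up pρ]]].
move=> /(_ Bcomplete Bsmall Uultra Uwf)[ρ' + /eval_inj-/(_ Bcomplete Bsmall Uultra Uwf) ρρ'].
move=> /(ultra_mem_eql Bcomplete Uultra ρρ') Ug; apply/eval_inj => //.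
apply: (ultra_le Uultra (ultra_meet Uultra Ug Up)).
apply: meet_bsup_le => // _ [[a Aa] _ <-].
have pa := pρ (exist _ a Aa).
have : mem_val ρ (generic_name code) ⊓ p (exist _ a Aa) ≤ a.
  rewrite -[X in _ ≤ X]mem_generic_name.
  by apply: (le_mem_eql Bcomplete (ρ := ρ)); [apply: leIxr|exact: leIl].
move=> ha; apply: (le_eq_trans Bcomplete (τ := check B (code a))).
  exact: leIxr.
by apply: le_eq_sym; apply: le_trans ha _; exact: σA.
Qed.

Lemma j_at_eval f σ : (forall a, A a -> a ≤ eq_val σ (check B (f a))) ->
  j_at code U A f = eval U σ.
Proof.
move=> σA; have [β βA] := antichain_mixing Bcomplete Bsmall Amax (check B \o code).
rewrite /j_at /app (bA_eval βA).
set P := [set y | _]; have : P (the empty P).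
  apply: theP; exists (eval U σ); have [ω ωE ωP] := opair_name β σ.
  rewrite /P /= -ωE; apply/eval_mem => //; apply: ultra_antichain => a Aa.
  apply: (@le_mem_check _ _ (opair (code a) (f a))).
    by apply/in_graph; exists a.
  by apply: ωP; [exact: βA|exact: σA].
move: (the empty P) => y; rewrite /P /=.
move=> /(in_jmap_image (in_graph A f))[ρ [p [ρE pd Up pρ]]].
have sA : small_type V {a | A a} by exact: small_type_sig.
(* The pieces of the pair [ρ] are split into coordinates. The first coordinate is [b_A] modulo [U],
   so on the piece indexed by [a] every other member of [A] contributes [⊥], and the second
   coordinate agrees with [σ]. *)
have [σ1 σ1p] := mixing Bcomplete (fun a : {a | A a} => check B (code (sval a))) sA pd.
have [τ1 τ1p] := mixing Bcomplete (fun a : {a | A a} => check B (f (sval a))) sA pd.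
have [ω ωE ωP] := opair_name σ1 τ1.
have : eval U ρ = eval U ω.
  apply/eval_inj => //; apply: (ultra_le Uultra Up).
  apply: bsup_le => // _ [a _ <-]; apply: (le_eq_trans Bcomplete (pρ a)).
  by apply: le_eq_sym; apply: ωP.
rewrite ρE ωE => /opair_inj[/eval_inj-/(_ Bcomplete Bsmall Uultra Uwf) Uβ ->].
apply/eval_inj => //; apply: (ultra_le Uultra (ultra_meet Uultra Uβ Up)).
apply: meet_bsup_le => // _ [[a Aa] _ <-].
apply: (le_antichain Bcomplete Amax) => a' Aa'.
have := σ1p (exist _ a Aa); have := τ1p (exist _ a Aa) => /=.
move: (p _) => b h1 h2; have := βA _ Aa' => /= h3.
have [e|ne] := EM (a' = a); last first.
  apply: (@le_trans _ _ (eq_val (check B (code a')) (check B (code a)))).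
    apply: (le_eq_trans Bcomplete (τ := β)); first by apply: le_eq_sym; meet_le.
    by apply: (le_eq_trans Bcomplete (τ := σ1)); meet_le.
  by rewrite eq_check_check ?le0x // => /code_inj.
apply: (le_eq_trans Bcomplete (τ := check B (f a))); first by meet_le.
by apply: le_eq_sym; rewrite e; apply: leIxl; exact: σA.
Qed.

(** [pi_infty] chooses a representative of the class; functions equal almost everywhere have
    mixtures equal modulo [U], so the choice is harmless. *)
Lemma pi_infty_fun_eval f : pi_infty code U A (fun_eval U A f) = j_at code U A f.
Proof.
rewrite /pi_infty; set P := [set z | _].
have [g] : P (the empty P) by apply: theP; exists (j_at code U A f), f.
move=> /(fun_eval_inj Bcomplete Bsmall Uultra Uwf Amax) fg ->.
have [σ σP] := antichain_mixing Bcomplete Bsmall Amax (check B \o f).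
have [τ τP] := antichain_mixing Bcomplete Bsmall Amax (check B \o g).
rewrite (j_at_eval σP) (j_at_eval τP); apply/eval_inj => //.
apply: (ae_ultra Bcomplete Uultra fg) => a Aa e.
apply: (le_eq_trans Bcomplete (τP _ Aa)); apply: le_eq_sym.
by rewrite /= -e; exact: σP.
Qed.

(* If [w] represents [G_A] then, almost everywhere, [{b | code b ∈ w a}] is the
   ultrafilter that [G_A] represents: truth in the ultrapower by [U_A] of
   "[c a] belongs to it" is membership in [U] of the mixture of [c] along [A]. *)
Lemma GA_ultra w (c : B -> B) : GA code U A = ext_of (fun_eval U A w) ->
  ae U A (fun a => code (c a) ∈ w a) <->
  exists2 b, U b & forall a, A a -> a ⊓ b ≤ c a.
Proof.
move=> wG; have [σ σP] := antichain_mixing Bcomplete Bsmall Amax (check B \o code \o c).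
have -> : ae U A (fun a => code (c a) ∈ w a) <-> U (mem_val σ (generic_name code)).
  rewrite -(fun_eval_mem Bcomplete Bsmall Uultra Uwf Amax (code \o c)).
  rewrite -[_ ∈ _]/(ext_of (fun_eval U A w) _) -wG /GA /= pi_infty_fun_eval.
  rewrite (j_at_eval σP) -(eval_mem Bcomplete Bsmall Uultra Uwf σ (generic_name code)).
  by split=> [[]|] // h; split=> //; exists (code \o c).
split=> [h|[b Ub bc]].
  exists (mem_val σ (generic_name code)) => // a Aa; rewrite -[X in _ ≤ X]mem_generic_name.
  apply: (le_mem_eql Bcomplete (ρ := σ)); last exact: leIr.
  by apply: leIxl; exact: σP.
apply: (ultra_le Uultra Ub); apply: (le_antichain Bcomplete Amax) => a Aa.
apply: (le_mem_eql Bcomplete (ρ := check B (code (c a)))).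
  by apply: leIxl; apply: le_eq_sym; exact: σP.
by rewrite mem_generic_name; exact: bc.
Qed.

End Antichain.
End Embedding.

(** * Representing the quotient by [U] in [M_A] through ultrafilters [W a] *)

Section Representation.
Variables (V : universe) (d : Order.disp_t) (B : ctbDistrLatticeType d).
Hypothesis Bcomplete : is_complete B.
Hypothesis Bsmall : small_type V B.
Variables (U A : set B).
Hypothesis Uultra : ultrafilter U.
Hypothesis Uwf : well_founded_VBU V U.
Hypothesis Amax : maximal_antichain A.
(** The condition [WU] is what [GA_ultra] provides for [W a = {b | code b ∈ w a}]; its right side
    says that the mixture of [c] along [A] is in [U]. *)
Variable W : B -> set B.
Hypothesis WU : forall c : B -> B, ae U A (fun a => W a (c a)) <->
  exists2 b, U b & forall a, A a -> a ⊓ b ≤ c a.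
Local Notation name := (name V B).
Implicit Types (σ τ ρ : name) (s t : B -> name) (a b c : B) (P Q : B -> Prop).

Let ae_by_contra P : (ae U A (fun a => ~ P a) -> False) -> ae U A P.
Proof. by move=> h; apply: contrapT => /(ae_not Bcomplete Uultra Amax). Qed.

(** If an ultrafilter axiom failed almost everywhere, the counterexamples could be chosen as
    functions on [A], and through [WU] the corresponding property of [U] refutes them. *)
Lemma ultra_top_ae : ae U A (fun a => ultrafilter (W a)).
Proof.
have glue (u : B -> B) : exists b, forall a, A a -> a ⊓ b = a ⊓ u a.
  exists (bsup [set a ⊓ u a | a in A]) => a Aa; apply/eqP; rewrite eq_le.
  apply/andP; split; last first.
    by rewrite lexI leIl /=; apply: le_bsup => //; exists a.
  apply: meet_bsup_le => // _ [a' Aa' <-].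
  have [->|/(antichain_disjoint Amax Aa Aa') aa'] := EM (a = a'); first by meet_le.
  by rewrite meetA aa' meet0x le0x.
have ultra1 : ae U A (fun a => W a ⊤).
  by apply/WU; exists ⊤; [exact: ultra_top|move=> a _; exact: lex1].
have ultra2 : ae U A (fun a => ~ W a ⊥).
  apply: (ae_not Bcomplete Uultra Amax) => /WU[b Ub b0]; apply: (ultra_bot Uultra).
  by apply: (ultra_le Uultra Ub); exact: (le_antichain Bcomplete Amax).
have ultra3 : ae U A (fun a => forall u v, W a u -> u ≤ v -> W a v).
  apply: ae_by_contra => h.
  have {}h : ae U A (fun a => exists u : B * B, [/\ W a u.1, u.1 ≤ u.2 & ~ W a u.2]).
    apply: (ae_mono Bcomplete Uultra h) => a _ /existsNP[u] /existsNP[v].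
    by move=> /not_implyP[Wu /not_implyP[uv Wv]]; exists (u, v).
  have [f fP] := choice_in (⊥, ⊥)
    (fun a (e : exists u : B * B, [/\ W a u.1, u.1 ≤ u.2 & ~ W a u.2]) => e).
  have : ae U A (fun a => W a (f a).1).
    by apply: (ae_mono Bcomplete Uultra h) => a _ /fP[].
  have : ae U A (fun a => (f a).1 ≤ (f a).2).
    by apply: (ae_mono Bcomplete Uultra h) => a _ /fP[].
  move=> hle /WU[b Ub bf].
  have : ae U A (fun a => W a (f a).2).
    (* The inequality between the components of [f a] is known only almost everywhere, so [b] is met
       with the join of those [a] where it holds. *)
    apply/WU; exists (b ⊓ bsup [set a | A a /\ (f a).1 ≤ (f a).2]).
      exact: ultra_meet.
    move=> a Aa; rewrite meetA; apply: meet_bsup_le => // a' [Aa' le'].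
    have [->|/(antichain_disjoint Amax Aa Aa') aa'] := EM (a = a').
      by apply: le_trans le'; apply: leIxl; exact: bf.
    by rewrite meetAC aa' meet0x le0x.
  move=> /(ae_and Bcomplete Uultra Amax h) /(ae_false Bcomplete Uultra).
  by apply=> a _ [/fP[]].
have ultra4 : ae U A (fun a => forall u v, W a u -> W a v -> W a (u ⊓ v)).
  apply: ae_by_contra => h.
  have {}h : ae U A (fun a => exists u : B * B,
      [/\ W a u.1, W a u.2 & ~ W a (u.1 ⊓ u.2)]).
    apply: (ae_mono Bcomplete Uultra h) => a _ /existsNP[u] /existsNP[v].
    by move=> /not_implyP[Wu /not_implyP[uv Wv]]; exists (u, v).
  have [f fP] := choice_in (⊥, ⊥)
    (fun a (e : exists u : B * B, [/\ W a u.1, W a u.2 & ~ W a (u.1 ⊓ u.2)]) => e).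
  have /WU[b Ub bf] : ae U A (fun a => W a (f a).1).
    by apply: (ae_mono Bcomplete Uultra h) => a _ /fP[].
  have /WU[b' Ub' bf'] : ae U A (fun a => W a (f a).2).
    by apply: (ae_mono Bcomplete Uultra h) => a _ /fP[].
  have : ae U A (fun a => W a ((f a).1 ⊓ (f a).2)).
    apply/WU; exists (b ⊓ b'); first exact: ultra_meet.
    move=> a Aa; rewrite lexI; apply/andP; split.
      by apply: le_trans (bf _ Aa); meet_le.
    by apply: le_trans (bf' _ Aa); meet_le.
  move=> /(ae_and Bcomplete Uultra Amax h) /(ae_false Bcomplete Uultra).
  by apply=> a _ [/fP[]].
have ultra5 : ae U A (fun a => forall u, W a u \/ W a (Order.compl u)).
  apply: ae_by_contra => h.
  have {}h : ae U A (fun a => exists u, ~ W a u /\ ~ W a (Order.compl u)).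
    by apply: (ae_mono Bcomplete Uultra h) => a _ /existsNP[u /not_orP]; exists u.
  have [f fP] := choice_in ⊥
    (fun a (e : exists u, ~ W a u /\ ~ W a (Order.compl u)) => e).
  (* [U] decides the mixture [b] of the counterexamples, and either answer puts [f a] or its
     complement in [W a] almost everywhere. *)
  have [b bf] := glue f.
  have [Ub|/(ultra_compl Uultra) Ub] := EM (U b).
    have : ae U A (fun a => W a (f a)).
      by apply/WU; exists b => // a Aa; rewrite bf //; meet_le.
    move=> /(ae_and Bcomplete Uultra Amax h) /(ae_false Bcomplete Uultra).
    by apply=> a _ [/fP[]].
  have : ae U A (fun a => W a (Order.compl (f a))).
    apply/WU; exists (Order.compl b) => // a Aa.
    by rewrite le_compl meetAC -bf // -meetA meetxC meetx0.
  move=> /(ae_and Bcomplete Uultra Amax h) /(ae_false Bcomplete Uultra).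
  by apply=> a _ [/fP[]].
have h12 := ae_and Bcomplete Uultra Amax ultra1 ultra2.
have h34 := ae_and Bcomplete Uultra Amax ultra3 ultra4.
have h := ae_and Bcomplete Uultra Amax (ae_and Bcomplete Uultra Amax h12 h34) ultra5.
by apply: (ae_mono Bcomplete Uultra h) => a _ [[[? ?] [? ?]] ?]; split.
Qed.

(* [σ] agrees with the class of [s] in the ultrapower of V^B by [U_A]. *)
Definition represents σ s : Prop :=
  exists2 b, U b & forall a, A a -> a ⊓ b ≤ eq_val σ (s a).

Lemma represents_mixing s : exists σ, represents σ s.
Proof.
have [σ σP] := antichain_mixing Bcomplete Bsmall Amax s.
by exists σ, ⊤ => [|a /σP]; [exact: ultra_top|rewrite meetx1].
Qed.

Lemma represents_const σ : represents σ (fun=> σ).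
Proof. by exists ⊤ => [|a _]; [exact: ultra_top|exact: le_eq_refl]. Qed.

(** A form of Łoś's theorem: modulo [U], the value of [σ] in [τ] is the mixture of the values of
    [s a] in [t a], and [WU] translates its membership in [U]. *)
Lemma represents_mem σ τ s t : represents σ s -> represents τ t ->
  U (mem_val σ τ) <-> ae U A (fun a => W a (mem_val (s a) (t a))).
Proof.
move=> [b Ub bs] [b' Ub' bt]; rewrite WU; split.
  move=> h; exists (b ⊓ b' ⊓ mem_val σ τ).
    by do 2!apply: ultra_meet => //.
  move=> a Aa; apply: (le_mem_eqr Bcomplete (σ := τ)).
    by apply: le_trans (bt _ Aa); meet_le.
  apply: (le_mem_eql Bcomplete (ρ := σ)); last by meet_le.
  by apply: le_trans (bs _ Aa); meet_le.
move=> [b0 Ub0 b0st].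
apply: (ultra_le Uultra (ultra_meet Uultra (ultra_meet Uultra Ub Ub') Ub0)).
apply: (le_antichain Bcomplete Amax) => a Aa; apply: (le_mem_eqr Bcomplete (σ := t a)).
  by apply: le_eq_sym; apply: le_trans (bt _ Aa); meet_le.
apply: (le_mem_eql Bcomplete (ρ := s a)).
  by apply: le_eq_sym; apply: le_trans (bs _ Aa); meet_le.
by apply: le_trans (b0st _ Aa); meet_le.
Qed.

(** If almost every [s a] were inaccessible, it would have an inaccessible member [t a]; the mixture
    of these members is a member of [σ], against the induction hypothesis. *)
Lemma represents_acc σ s : represents σ s ->
  ae U A (fun a => Acc (name_mem (W a)) (name_class (W a) (s a))).
Proof.
have [C eC] : exists C, C = name_class U σ by exists (name_class U σ).
elim/(well_founded_ind Uwf): C σ s eC => C IH σ s eC σs.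
apply: ae_by_contra => h.
have {}h : ae U A (fun a => exists t : name, W a (mem_val t (s a)) /\
    ~ Acc (name_mem (W a)) (name_class (W a) t)).
  apply: (ae_mono2 Bcomplete Uultra Amax ultra_top_ae h) => a _ Wa.
  apply: contra_notP => /forallNP nt; constructor => _ [ρ [τ [-> /name_class_eq]]].
  move=> /(_ Bcomplete Wa) sτ /(ultra_mem_eqr Bcomplete Wa (ultra_eq_sym sτ)) Wρ.
  by have /not_andP[//|/contrapT] := nt ρ.
have [t tP] := choice_in (check B empty) (fun a (e : exists t : name, W a (mem_val t (s a)) /\
    ~ Acc (name_mem (W a)) (name_class (W a) t)) => e).
have [τ τt] := represents_mixing t.
have : ae U A (fun a => Acc (name_mem (W a)) (name_class (W a) (t a))).
  apply: (IH _ _ τ) => //; rewrite eC; apply/name_memE => //.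
  by apply/(represents_mem τt σs); apply: (ae_mono Bcomplete Uultra h) => a _ /tP[].
move=> /(ae_and Bcomplete Uultra Amax h) /(ae_false Bcomplete Uultra).
by apply=> a _ [/tP[]].
Qed.

Lemma wf_ae : ae U A (fun a => well_founded_VBU V (W a)).
Proof.
apply: ae_by_contra => h.
have {}h : ae U A (fun a => exists t : name, ~ Acc (name_mem (W a)) (name_class (W a) t)).
  apply: (ae_mono Bcomplete Uultra h) => a _; apply: contra_notP => /forallNP nt C.
  constructor => _ [ρ [τ [-> _ _]]]; exact: contrapT.
have [t tP] := choice_in (check B empty)
  (fun a (e : exists t : name, ~ Acc (name_mem (W a)) (name_class (W a) t)) => e).
have [τ /represents_acc] := represents_mixing t.
move=> /(ae_and Bcomplete Uultra Amax h) /(ae_false Bcomplete Uultra).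
by apply=> a _ [/tP].
Qed.

(** Induction along the quotient by [U]. A member of [σ] is represented by a constant function;
    conversely, a member of the right side consists of values of chosen names [t a], whose mixture
    is a member of [σ]. *)
Lemma represents_eval σ s : represents σ s ->
  eval U σ = fun_eval U A (fun a => eval (W a) (s a)).
Proof.
have good := ae_and Bcomplete Uultra Amax ultra_top_ae wf_ae.
have [C eC] : exists C, C = name_class U σ by exists (name_class U σ).
elim/(well_founded_ind Uwf): C σ s eC => C IH σ s eC σs.
apply: set_ext => z; split.
  move=> /in_eval-/(_ Bcomplete Bsmall Uultra Uwf)[ρ Uρ <-].
  rewrite (IH (name_class U ρ) _ ρ (fun=> ρ) erefl (represents_const ρ)); last first.
    by rewrite eC; apply/name_memE.
  apply/fun_eval_mem => //; move: Uρ.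
  move=> /(represents_mem (represents_const ρ) σs) h.
  by apply: (ae_mono2 Bcomplete Uultra Amax good h) => a _ [? ?] ?; apply/eval_mem.
move=> /in_fun_eval-/(_ Bcomplete Bsmall Uultra Uwf Amax)[f fs <-].
have {}fs : ae U A (fun a => exists t : name, W a (mem_val t (s a)) /\ eval (W a) t = f a).
  apply: (ae_mono2 Bcomplete Uultra Amax good fs) => a _ [? ?].
  by move=> /in_eval-/(_ Bcomplete Bsmall)[]// t ? ?; exists t.
have [t tP] := choice_in (check B empty)
  (fun a (e : exists t : name, W a (mem_val t (s a)) /\ eval (W a) t = f a) => e).
have [τ τt] := represents_mixing t.
have Uτ : U (mem_val τ σ).
  by apply/(represents_mem τt σs); apply: (ae_mono Bcomplete Uultra fs) => a _ /tP[].
have -> : fun_eval U A f = eval U τ.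
  rewrite (IH (name_class U τ) _ τ t erefl τt); last by rewrite eC; apply/name_memE.
  by apply/fun_eval_inj => //; apply: (ae_mono Bcomplete Uultra fs) => a _ /tP[].
exact/eval_mem.
Qed.

End Representation.

(** * The two inclusions for a simple skeleton *)

Section BukovskyDehornoy.
Variables (V : universe) (d : Order.disp_t) (B : ctbDistrLatticeType d).
Hypothesis Bcomplete : is_complete B.
Variable code : B -> V.
Hypothesis code_inj : injective code.
Hypothesis code_small : is_small (range code).
Variable U : set B.
Hypothesis Uultra : ultrafilter U.
Hypothesis Uwf : well_founded_VBU V U.
Variable F : set (set B).
Hypothesis Fskel : simple_skeleton code U F.
Local Notation name := (name V B).
Implicit Types (σ τ ρ η : name) (a b : B) (A : set B) (x y X : V).

Let Bsmall : small_type V B.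
Proof. by exists code. Qed.

Let Fmax A : F A -> maximal_antichain A.
Proof. by have [[+ _ _ _] _] := Fskel; apply. Qed.

Lemma simple_ultrafilters A : F A -> exists W : B -> set B,
  forall c : B -> B, ae U A (fun a => W a (c a)) <->
    exists2 b, U b & forall a, A a -> a ⊓ b ≤ c a.
Proof.
move=> FA; have [_ /(_ A FA)[_ [w _ <-] wG]] := Fskel.
exists (fun a => [set b | code b ∈ w a]) => c; apply: GA_ultra => //.
exact: Fmax.
Qed.

Lemma VBU_sub_MA A : F A -> VBU V U `<=` MA V U A.
Proof.
move=> FA _ [σ _ <-]; have [W WU] := simple_ultrafilters FA.
exists (fun a => eval (W a) σ) => //; symmetry.
apply: (represents_eval Bcomplete Bsmall Uultra Uwf (Fmax FA) WU).
exact: represents_const.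
Qed.

(** The mixture [ι] of the check names of the indices lies in the Boolean ultrapower, hence is
    [j(f)(b_A)] for some [A] in the skeleton; modulo [U], the index valid on [a] is then [f a]. *)
Lemma skeleton_index x (p : elt x -> B) :
  disjoint_family p -> U (bsup (range p)) ->
  exists2 A, F A & exists g : B -> elt x,
    exists2 b, U b & forall a, A a -> a ⊓ b ≤ p (g a).
Proof.
move=> pd Up.
(* An empty join would be [⊥]. The index [i0] is the default where [f a] is not in [x]; there every
   piece contributes [⊥]. *)
have [i0 _] : exists i0 : elt x, True.
  apply: contrapT => /forallNP ni; apply: (ultra_bot Uultra).
  by apply: (ultra_le Uultra Up); apply: bsup_le => // _ [i _ <-]; case: (ni i).
have [ι ιp] := mixing Bcomplete (fun i : elt x => check B (sval i)) (small_type_elt x) pd.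
have : boolean_ultrapower V U (eval U ι).
  exists ι => //; apply: (ultra_le Uultra Up); apply: bsup_le => // _ [i _ <-].
  by apply: le_trans (ιp i) _; apply: le_bsup => //; exists (sval i).
have [[_ _ _ ->] _] := Fskel; move=> [A [FA [f]]]; have Amax := Fmax FA.
have [σ σf] := antichain_mixing Bcomplete Bsmall Amax (check B \o f).
rewrite (j_at_eval Bcomplete code_inj code_small Uultra Uwf Amax σf).
move=> /eval_inj-/(_ Bcomplete Bsmall Uultra Uwf) ισ; exists A => //.
have /choice[g gP] : forall a, exists i : elt x, f a ∈ x -> sval i = f a.
  move=> a; have [fx|fx] := EM (f a ∈ x); last by exists i0.
  by exists (exist _ (f a) fx).
exists g; exists (eq_val ι σ ⊓ bsup (range p)); first exact: ultra_meet.
move=> a Aa; rewrite meetA; apply: meet_bsup_le => // _ [i _ <-].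
have [e|ne] := EM (sval i = f a).
  suff -> : g a = i by exact: leIr.
  by apply: elt_inj; rewrite e; apply: gP; rewrite -e; exact: (svalP i).
apply: (@le_trans _ _ (eq_val (check B (sval i)) (check B (f a)))).
  apply: (le_eq_trans Bcomplete (τ := ι)).
    by apply: le_eq_sym; apply: le_trans (ιp i); exact: leIr.
  apply: (le_eq_trans Bcomplete (τ := σ)); first by meet_le.
  by apply: le_trans (σf _ Aa); meet_le.
by rewrite eq_check_check // le0x.
Qed.

(* As [η] names [j[F]], a union over "[A ∈ j[F]]" that is in [U] is already
   in [U] at some [A] of [F]. *)
Lemma skeleton_ultra η (c : set B -> B) :
  ext_of (eval U η) = [set jmap U (code_set code A) | A in F] ->
  U (bsup (range (fun A => mem_val (check B (code_set code A)) η ⊓ c A))) ->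
  exists2 A, F A & U (c A).
Proof.
move=> ηF /(ultra_mixing Bcomplete Uultra (fun A => check B (code_set code A))
             (small_type_set Bsmall))[θ [p [pc pd Up pθ]]].
have Uθη : U (mem_val θ η).
  apply: (ultra_le Uultra Up); apply: bsup_le => // _ [A _ <-].
  apply: (le_mem_eql Bcomplete (ρ := check B (code_set code A))).
    exact/le_eq_sym/pθ.
  by apply: le_trans (pc A) _; exact: leIl.
have : ext_of (eval U η) (eval U θ) by apply/eval_mem.
rewrite ηF => -[A FA /eval_inj-/(_ Bcomplete Bsmall Uultra Uwf) Aθ].
(* The pieces of [θ] belonging to other antichains contribute [⊥] once [θ] equals the check name of
   [A], so what remains is below [c A]. *)
exists A => //; apply: (ultra_le Uultra (ultra_meet Uultra Aθ Up)).
apply: meet_bsup_le => // _ [A' _ <-].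
have [->|ne] := EM (A = A').
  by apply: leIxr; apply: le_trans (pc A') _; exact: leIr.
apply: (@le_trans _ _ (eq_val (check B (code_set code A)) (check B (code_set code A')))).
  apply: (le_eq_trans Bcomplete (τ := θ)); first exact: leIl.
  by apply: leIxr; exact: pθ.
by rewrite eq_check_check ?le0x // => /(code_set_inj code_inj code_small).
Qed.

Lemma bigcap_MA_sub_VBU : \bigcap_(A in F) MA V U A `<=` VBU V U.
Proof.
have [[_ _ [_ [η _ <-] ηF] _] _] := Fskel.
have eF A : F A -> U (mem_val (check B (code_set code A)) η).
  move=> FA; apply/eval_mem => //.
  by rewrite -[_ ∈ _]/(ext_of (eval U η) _) ηF; exists A.
have [W WU] := choice_in (fun=> set0) simple_ultrafilters.
move=> X; elim/(well_founded_ind (smem_wf V)): X => X IH XM.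
have [f fX] : exists f : set B -> B -> V, forall A, F A -> fun_eval U A (f A) = X.
  apply: (@choice_in _ _ (fun=> empty) F (fun A g => fun_eval U A g = X)) => A.
  by move=> /XM[g _ <-]; exists g.
(* Each [M_A] is transitive, so the elements of [X] are again in every [M_A] and the induction
   hypothesis names them. *)
have /choice[s sE] : forall i : elt X, exists σ, eval U σ = sval i.
  move=> [x xX] /=; have [|σ _ <-] := IH x xX; last by exists σ.
  move=> A FA; move: (xX); rewrite -(fX A FA).
  by move=> /in_fun_eval-/(_ Bcomplete Bsmall Uultra Uwf (Fmax FA))[g _ <-]; exists g.
pose v A (i : elt X) := bsup [set a | A a /\ eval (W A a) (s i) ∈ f A a].
(* [U] need not be closed under infinite meets, so the [v A i] are not simply met over [F];
   weakening each by the value of [A] being in [η] brings [skeleton_ultra] to bear. *)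
pose u (i : elt X) := binf (range (fun A =>
  bimp (mem_val (check B (code_set code A)) η) (v A i))).
have Xv A τ (g : B -> elt X) : F A ->
    represents U A τ (s \o g) ->
    eval U τ ∈ X <-> ae U A (fun a => eval (W A a) (s (g a)) ∈ f A a).
  move=> FA; have Amax := Fmax FA.
  move=> /(represents_eval Bcomplete Bsmall Uultra Uwf Amax (WU A FA)) ->.
  have fXA y : y ∈ X <-> y ∈ fun_eval U A (f A) by rewrite fX.
  by rewrite fXA; exact: fun_eval_mem.
(* Otherwise [skeleton_ultra] gives an [A] in [F] with [v A i] outside [U], which by [Xv] says that
   the [i]-th element of [X] is not in [X]. *)
have Uu i : U (u i).
  apply: contrapT => /(ultra_compl Uultra) /(ultra_le Uultra).
  move=> /(_ _ (compl_binf_bimp Bcomplete _ _)) /(skeleton_ultra ηF)[A FA].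
  move=> /(ultra_compl Uultra); apply; apply/(Xv A (s i) (fun=> i) FA).
    exact: represents_const.
  by rewrite sE; exact: (svalP i).
exists (Name s u) => //; apply: set_ext => y; split; last first.
  move=> yX; rewrite -[y]/(sval (exist (fun y => y ∈ X) y yX)) -sE.
  apply/eval_mem => //; apply: (ultra_le Uultra (Uu (exist _ y yX))).
  apply: (@le_mem_val _ _ _ Bcomplete _ (Name s u) (exist _ y yX)) => //.
  exact: le_eq_refl.
move=> /in_eval-/(_ Bcomplete Bsmall Uultra Uwf)[τ Uτ <-].
have [p [pc pd cp]] := disjointify Bcomplete (fun i => u i ⊓ eq_val τ (s i)).
have [A FA [g [b Ub bp]]] := skeleton_index pd (ultra_le Uultra Uτ cp).
have bA a : A a -> a ⊓ b ≤ u (g a) ⊓ eq_val τ (s (g a)).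
  by move=> Aa; apply: le_trans (bp a Aa) (pc _).
apply/(Xv A τ g FA).
  by exists b => // a /bA/le_trans; apply; exact: leIr.
(* Below [a ⊓ b] the value [u (g a)] holds, so meeting with the value of [A] being in [η] leads
   below [v A (g a)]. If the membership fails at [a], that join runs over members of [A] other than
   [a], all disjoint from [a]. *)
apply: (ultra_ae Bcomplete Uultra (Fmax FA) (ultra_meet Uultra Ub (eF A FA))) => a Aa nfa.
apply/eqP; rewrite -lex0 meetA.
apply: (@le_trans _ _ (a ⊓ v A (g a))).
  rewrite lexI; apply/andP; split; first by meet_le.
  rewrite -le_bimp; apply: le_trans (bA _ Aa) _; apply: leIxl.
  by apply: binf_le => //; exists A.
apply: meet_bsup_le => // a' [Aa' fa'].
by rewrite (antichain_disjoint (Fmax FA)) // => aa'; apply: nfa; rewrite -aa' in fa'.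
Qed.

End BukovskyDehornoy.

Theorem theorem3p9 (V : universe) (d : Order.disp_t) (B : ctbDistrLatticeType d)
    (code : B -> V) (U : set B) (F : set (set B)) :
  injective code -> is_small (range code) ->
  is_complete B ->
  ultrafilter U ->
  well_founded_VBU V U ->
  simple_skeleton code U F ->
  VBU V U = \bigcap_(A in F) MA V U A.
Proof.
move=> code_inj code_small Bc Uu Uwf Fs; apply/seteqP; split.
  by move=> x Ux A FA; exact: (VBU_sub_MA Bc code_inj code_small Uu Uwf Fs FA).
exact: (bigcap_MA_sub_VBU Bc code_inj code_small Uu Uwf Fs).
Qed.
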